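(* If the number $N$ of resonators in the unit cell is less than $3$ (i.e. $N=1$ or $N=2$), then the reciprocity of the system of ODEs $$\frac{\mathrm{d}^2\phi}{\mathrm{d} t^2}(t)+M^\alpha(t)\phi(t)=0$$ is always preserved; that is, for every $\alpha\in Y^*$, $\alpha\neq 0$, the set of quasifrequencies of this system at $\alpha$ coincides with the set of quasifrequencies at $-\alpha$.
   Context: Geometry. Let $d\in\{2,3\}$, let $\Lambda\subset\mathbb{R}^d$ be a lattice with unit cell $Y\subset\mathbb{R}^d$ of volume $|Y|$, dual lattice $\Lambda^*$ (the $q\in\mathbb{R}^d$ with $q\cdot l\in 2\pi\mathbb{Z}$ for all $l\in\Lambda$), and Brillouin zone $Y^*:=\mathbb{R}^d/\Lambda^*$. Let $D=D_1\cup\dots\cup D_N\Subset Y$, where the $D_i$ (the resonators) are disjoint connected domains with boundary $\partial D_i$ of class $C^{1,s}$, $0<s<1$, and volume $|D_i|$. Capacitance matrix. For $\alpha\in Y^*$, $\alpha\neq 0$, let $G^{\alpha,0}(x,y)=-\frac{1}{|Y|}\sum_{q\in\Lambda^*}\frac{e^{\mathrm{i}(\alpha+q)\cdot(x-y)}}{|\alpha+q|^2}$ be the $\alpha$-quasiperiodic Green's function of the Laplacian, and let $\mathcal{S}_D^{\alpha,0}[\varphi](x)=\int_{\partial D}G^{\alpha,0}(x,y)\varphi(y)\,\mathrm{d}\sigma(y)$, which is invertible as a map $L^2(\partial D)\to H^1(\partial D)$. Put $\psi_j^\alpha=(\mathcal{S}_D^{\alpha,0})^{-1}[\chi_{\partial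 D_j}]$ and $C^\alpha_{ij}=-\int_{\partial D_i}\psi_j^\alpha\,\mathrm{d}\sigma$. The $N\times N$ matrix $C^\alpha=(C^\alpha_{ij})$ is the capacitance matrix; it is known to be Hermitian. Modulated system. Let $T>0$, $\Omega=2\pi/T$. For $i=1,\dots,N$ let $\rho_i,\kappa_i$ be positive $T$-periodic functions of $t\in\mathbb{R}$ such that $1/\rho_i$ and $1/\kappa_i$ have finite Fourier series (trigonometric polynomials in $e^{\mathrm{i}\Omega t}$). Let $\delta,\kappa_r,\rho_r>0$ be constants and $$M^\alpha(t)=\frac{\delta\kappa_r}{\rho_r}W_1(t)C^\alpha W_2(t)+W_3(t),$$ where $W_1,W_2,W_3$ are diagonal with $(W_1)_{ii}=\frac{\sqrt{\kappa_i}\rho_i}{|D_i|}$, $(W_2)_{ii}=\frac{\sqrt{\kappa_i}}{\rho_i}$, $(W_3)_{ii}=\frac{\sqrt{\kappa_i}}{2}\frac{\mathrm{d}}{\mathrm{d}t}\frac{\mathrm{d}\kappa_i/\mathrm{d}t}{\kappa_i^{3/2}}$. Quasifrequencies. A quasifrequency of the system at $\alpha$ is an $\omega\in\mathbb{C}/(\Omega\mathbb{Z})$ for which there is a nonzero solution $\phi:\mathbb{R}\to\mathbb{C}^N$ with $\phi(t+T)=e^{\mathrm{i}\omega T}\phi(t)$ for all $t$. *)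

(* Defs.v *)
(* Library: MathComp and MathComp-Analysis, complex numbers [R[i]] from
   mathcomp-real-closed, over an arbitrary [R : realType]. *)
From HB Require Import structures.
From mathcomp Require Import all_boot all_order all_algebra.
From mathcomp Require Import complex.
From mathcomp Require Import all_classical all_reals all_analysis.

Set Implicit Arguments.
Unset Strict Implicit.
Unset Printing Implicit Defensive.

Import Order.TTheory GRing.Theory Num.Theory.
Import numFieldNormedType.Exports.

Local Open Scope classical_set_scope.
Local Open Scope complex_scope.
Local Open Scope ring_scope.

(** Complex-valued limits, integrals and derivatives, taken componentwise.
    [limn] is [0] on divergent real sequences, and the real-valued [\int] is [0]
    when the integral is infinite. *)

Section complex_calculus.
Context {R : realType}.

Definition expi (x : R) : R[i] := cos x +i* sin x.

Definition cexp (z : R[i]) : R[i] := (expR (complex.Re z))%:C * expi (complex.Im z).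

Definition csqnorm (z : R[i]) : R := complex.Re z ^+ 2 + complex.Im z ^+ 2.

Definition climn (u : nat -> R[i]) : R[i] :=
  limn (fun n => complex.Re (u n)) +i* limn (fun n => complex.Im (u n)).

Definition cmeasurable_fun d (T : measurableType d) (A : set T) (f : T -> R[i]) :=
  measurable_fun A (fun x => complex.Re (f x)) /\
  measurable_fun A (fun x => complex.Im (f x)).

Definition cintegrable d (T : measurableType d) (mu : {measure set T -> \bar R})
    (A : set T) (f : T -> R[i]) :=
  mu.-integrable A (fun x => (complex.Re (f x))%:E) /\
  mu.-integrable A (fun x => (complex.Im (f x))%:E).

Definition cintegral d (T : measurableType d) (mu : {measure set T -> \bar R})
    (A : set T) (f : T -> R[i]) : R[i] :=
  (\int[mu]_(x in A) complex.Re (f x)) +i* (\int[mu]_(x in A) complex.Im (f x)).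

Definition cderivable (f : R -> R[i]) (t : R) :=
  derivable (fun u => complex.Re (f u)) t 1 /\
  derivable (fun u => complex.Im (f u)) t 1.

Definition cderive (f : R -> R[i]) (t : R) : R[i] :=
  derive1 (fun u => complex.Re (f u)) t +i* derive1 (fun u => complex.Im (f u)) t.

End complex_calculus.

Section euclidean.
Context {R : realType} {d : nat}.
Implicit Types (x y : 'rV[R]_d) (A B U : set 'rV[R]_d).

Definition dot x y : R := \sum_(k < d) x 0 k * y 0 k.

(* The library norm on row vectors is the sup norm. *)
Definition enorm x : R := Num.sqrt (dot x x).

Definition axis (k : 'I_d) : 'rV[R]_d := delta_mx 0 k.

Definition boundary A : set 'rV[R]_d := closure A `\` interior A.

(* Lebesgue outer measure. *)
Definition volume A : \bar R :=
  ereal_inf [set (\sum_(0 <= k <oo) (\prod_(i < d) (ab.2 k 0 i - ab.1 k 0 i))%:E)%E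
            | ab in [set ab : (nat -> 'rV[R]_d) * (nat -> 'rV[R]_d) |
                (forall k i, ab.1 k 0 i <= ab.2 k 0 i) /\
                A `<=` \bigcup_k
                  [set x | forall i, ab.1 k 0 i <= x 0 i <= ab.2 k 0 i]]].

(* The adjoined 0 only matters for the empty set. *)
Definition diam A : \bar R :=
  ereal_sup (0%E |` [set (enorm (xy.1 - xy.2))%:E | xy in A `*` A]).

(* Volume of the ball of diameter 1 in dimension [k]; only [k = 1, 2] are used. *)
Definition ball_const (k : nat) : R := if k == 2 then pi / 4 else 1.

Definition hausdorff_gauge (k : nat) (e : R) A : \bar R :=
  if `[< A = set0 >] then 0%E
  else if (diam A <= e%:E)%E then (ball_const k * fine (diam A) ^+ k)%:E
  else +oo%E.

Definition hausdorff_content (k : nat) (e : R) A : \bar R :=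
  ereal_inf [set (\sum_(0 <= j <oo) hausdorff_gauge k e (F j))%E
            | F in [set F : nat -> set 'rV[R]_d | A `<=` \bigcup_j F j]].

Definition hausdorff (k : nat) A : \bar R :=
  ereal_sup [set hausdorff_content k e A | e in [set e | 0 < e]].

Lemma hausdorff_gauge_ge0 k e A : (0 <= hausdorff_gauge k e A)%E.
Proof.
rewrite /hausdorff_gauge; case: ifP => // _; case: ifP => // _.
rewrite lee_fin mulr_ge0//.
  by rewrite /ball_const; case: ifP => // _; rewrite divr_ge0// pi_ge0.
apply: exprn_ge0; apply: fine_ge0.
by apply: ereal_sup_ubound; left.
Qed.

Lemma hausdorff_gauge0 k e : hausdorff_gauge k e set0 = 0%E.
Proof. by rewrite /hausdorff_gauge; case: ifPn => // /asboolPn. Qed.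

Lemma hausdorff_contentE k e :
  hausdorff_content k e =
  @mu_ext _ (g_sigma_algebraType [set: set 'rV[R]_d]) R (hausdorff_gauge k e).
Proof.
apply/funext => A; rewrite /hausdorff_content /mu_ext; congr ereal_inf.
apply/seteqP; split=> _ [F AF <-]; exists F => //; last by case: AF.
by split=> // i; exact: sub_sigma_algebra.
Qed.

Lemma hausdorff0 k : hausdorff k set0 = 0%E.
Proof.
have h e : hausdorff_content k e set0 = 0%E.
  by rewrite hausdorff_contentE mu_ext0 ?hausdorff_gauge0// => X;
    exact: hausdorff_gauge_ge0.
apply/eqP; rewrite eq_le; apply/andP; split.
  by apply: ge_ereal_sup => _ [e _ <-]; rewrite h.
by apply: ereal_sup_ubound; exists 1 => //=.
Qed.

Lemma hausdorff_content_le k e A : 0 < e ->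
  (hausdorff_content k e A <= hausdorff k A)%E.
Proof. by move=> e0; apply: ereal_sup_ubound; exists e. Qed.

Lemma hausdorff_ge0 k A : (0 <= hausdorff k A)%E.
Proof.
apply: (le_trans _ (@hausdorff_content_le k 1 A ltr01)).
by rewrite hausdorff_contentE; apply: mu_ext_ge0 => X; exact: hausdorff_gauge_ge0.
Qed.

Lemma le_hausdorff k : {homo hausdorff k : A B / A `<=` B >-> (A <= B)%E}.
Proof.
move=> A B AB; apply: ge_ereal_sup => _ [e e0 <-].
apply: (le_trans _ (@hausdorff_content_le k e B e0)).
by rewrite hausdorff_contentE; apply: le_mu_ext.
Qed.

Lemma hausdorff_sigma_subadditive k : sigma_subadditive (hausdorff k).
Proof.
move=> F; apply: ge_ereal_sup => _ [e e0 <-].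
have : (hausdorff_content k e (\bigcup_n F n) <=
        \sum_(i <oo) hausdorff_content k e (F i))%E.
  rewrite hausdorff_contentE.
  by apply: mu_ext_sigma_subadditive => X; exact: hausdorff_gauge_ge0.
move=> /le_trans; apply; apply: lee_nneseries => i _.
  by rewrite hausdorff_contentE => _; apply: mu_ext_ge0 => X; exact: hausdorff_gauge_ge0.
exact: hausdorff_content_le.
Qed.

HB.instance Definition _ (k : nat) := isOuterMeasure.Build R 'rV[R]_d (hausdorff k)
  (hausdorff0 k) (@hausdorff_ge0 k) (@le_hausdorff k)
  (@hausdorff_sigma_subadditive k).

End euclidean.

Section geometry.
Context {R : realType} {d : nat}.
Implicit Types (L Y D : set 'rV[R]_d) (g : 'rV[R]_d -> R) (s : R).

Definition is_lattice L :=
  exists2 B : 'M[R]_d, B \in unitmx &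
    L = [set map_mx intr z *m B | z in [set: 'rV[int]_d]].

Definition dual_lattice L : set 'rV[R]_d :=
  [set q | forall l, L l -> exists k : int, dot q l = 2 * pi * k%:~R].

(* The translates of [Y] by the lattice tile space, up to their null boundaries. *)
Definition is_unit_cell L Y :=
  [/\ forall x, exists2 l, L l & Y (x - l),
      forall l x, L l -> l != 0 -> ~ (interior Y x /\ interior Y (x - l)) &
      volume (boundary Y) = 0%E].

Definition C1s_fun s g :=
  (forall x k, derivable g x (axis k)) /\
  exists K : R, forall x y k,
    `|'D_(axis k) g x - 'D_(axis k) g y| <= K * enorm (x - y) `^ s.

(* Near each of its boundary points [D] is the region above the graph of a
   C^{1,s} function over a hyperplane. With [e] the unit vector orthogonal to
   that hyperplane, a function on the hyperplane is encoded as a function on the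
   whole space that is invariant under translations along [e]. *)
Definition C1s_boundary s D :=
  forall x0, boundary D x0 -> exists r : R, exists e : 'rV[R]_d, exists g,
    [/\ 0 < r, enorm e = 1, C1s_fun s g,
        forall x t, g (x + t *: e) = g x &
        forall x, enorm (x - x0) < r -> (D x <-> g x < dot x e)].

Definition resonators (N : nat) s Y (D : 'I_N -> set 'rV[R]_d) :=
  [/\ forall i, [/\ D i !=set0, open (D i), connected (D i) & C1s_boundary s (D i)],
      forall i j, i != j -> closure (D i) `&` closure (D j) = set0 &
      forall i, compact (closure (D i)) /\ closure (D i) `<=` interior Y].

End geometry.

(** Surface measure and function spaces on a hypersurface [B] of 'rV[R]_d.
    The surface measure is the Hausdorff measure of dimension d - 1, on the
    sigma-algebra of its Caratheodory-measurable sets (hence it is complete). *)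

Definition surface_outer (R : realType) (d : nat) :
    {outer_measure set 'rV[R]_d -> \bar R} := hausdorff d.-1.

Notation surface_space R d := (caratheodory_type (surface_outer R d)).

Definition surface_measure (R : realType) (d : nat) :
    {measure set (surface_space R d) -> \bar R} := surface_outer R d.

Section function_spaces.
Context {R : realType} {d : nat}.
Local Notation T := (surface_space R d).
Local Notation sigma := (surface_measure R d).
Implicit Types (B : set T) (f : T -> R[i]) (u : 'rV[R]_d -> R[i]).

Definition L2_sqnorm B f : \bar R := (\int[sigma]_(x in B) (csqnorm (f x))%:E)%E.

Definition L2 B f := cmeasurable_fun B f /\ (L2_sqnorm B f < +oo)%E.

Definition ae_eq_on B f1 f2 := {ae sigma, forall x, B x -> f1 x = f2 x}.

Definition C1_on (U : set 'rV[R]_d) (v : 'rV[R]_d -> R) :=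
  forall x k, U x -> derivable v x (axis k) /\
    {for x, continuous (fun y => 'D_(axis k) v y)}.

Definition C1_near B u :=
  exists U : set 'rV[R]_d, [/\ open U, B `<=` U,
    C1_on U (fun x => complex.Re (u x)) & C1_on U (fun x => complex.Im (u x))].

Definition partial u (k : 'I_d) (x : 'rV[R]_d) : R[i] :=
  'D_(axis k) (fun y => complex.Re (u y)) x +i*
  'D_(axis k) (fun y => complex.Im (u y)) x.

(* [nu] is orthogonal to the tangent cone of [B] at [x]; on a C^1 hypersurface
   this determines [nu] up to its sign, on which [tgrad] does not depend. *)
Definition is_unit_normal B (x nu : 'rV[R]_d) :=
  enorm nu = 1 /\
  forall e : R, 0 < e -> exists2 r : R, 0 < r & forall y : 'rV[R]_d, B y ->
    enorm (y - x) < r -> `|dot (y - x) nu| <= e * enorm (y - x).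

Definition normal B (x : 'rV[R]_d) : 'rV[R]_d := get (is_unit_normal B x).

Definition tgrad B u (k : 'I_d) (x : 'rV[R]_d) : R[i] :=
  partial u k x -
  (normal B x 0 k)%:C * \sum_(l < d) (normal B x 0 l)%:C * partial u l x.

(* [f] is in H^1(B) with tangential gradient [g]: H^1(B) is the completion, in
   the H^1 norm, of the functions that are C^1 near [B]. *)
Definition H1_tgrad B f (g : 'I_d -> T -> R[i]) :=
  [/\ L2 B f, forall k, L2 B (g k) &
      exists u : nat -> 'rV[R]_d -> R[i],
      [/\ forall n, C1_near B (u n),
          (fun n => L2_sqnorm B (fun x => u n x - f x)) @ \oo --> 0%E &
          forall k, (fun n => L2_sqnorm B (fun x => tgrad B (u n) k x - g k x))
            @ \oo --> 0%E]].

Definition H1 B f := exists g, H1_tgrad B f g.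

Definition H1_sqnorm B f (g : 'I_d -> T -> R[i]) : \bar R :=
  (L2_sqnorm B f + \sum_(k < d) L2_sqnorm B (g k))%E.

End function_spaces.

Section capacitance.
Context {R : realType} {d N : nat}.
Variables (L Y : set 'rV[R]_d) (D : 'I_N -> set 'rV[R]_d).
Local Notation T := (surface_space R d).
Local Notation sigma := (surface_measure R d).
Implicit Types (alpha : 'rV[R]_d) (f phi : T -> R[i]).

(* The lattice sum is not absolutely convergent: it is the limit of the partial
   sums over the balls |alpha + q| <= n. Centring them at -alpha makes the value
   depend only on the class of [alpha] modulo the dual lattice. *)
Definition green alpha (x y : 'rV[R]_d) : R[i] :=
  - ((fine (volume Y))^-1)%:C *
  climn (fun n => \sum_(q \in [set q | dual_lattice L q /\ enorm (alpha + q) <= n%:R])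
                    (expi (dot (alpha + q) (x - y)) / (enorm (alpha + q) ^+ 2)%:C)).

Definition bdD : set T := boundary (\bigcup_(i in [set: 'I_N]) D i).

Definition single_layer alpha phi : T -> R[i] :=
  fun x => cintegral sigma bdD (fun y => green alpha x y * phi y).

(* The single layer operator is well defined, bounded and invertible from
   L^2(bdD) to H^1(bdD), both taken modulo equality almost everywhere. *)
Definition single_layer_invertible alpha :=
  [/\ forall phi, L2 bdD phi -> {ae sigma, forall x, bdD x ->
        cintegrable sigma bdD (fun y => green alpha x y * phi y)},
      exists K : R, forall phi, L2 bdD phi ->
        exists2 g, H1_tgrad bdD (single_layer alpha phi) g &
          (H1_sqnorm bdD (single_layer alpha phi) g <= K%:E * L2_sqnorm bdD phi)%E,
      forall phi, L2 bdD phi -> ae_eq_on bdD (single_layer alpha phi) (fun=> 0) ->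
        ae_eq_on bdD phi (fun=> 0) &
      forall f, H1 bdD f ->
        exists2 phi, L2 bdD phi & ae_eq_on bdD (single_layer alpha phi) f].

(* As for [invmx], the inverse is given a conventional value (here [0]) when the
   operator is not invertible, which does not happen for [alpha] outside the
   dual lattice. *)
Definition single_layer_inv alpha f : T -> R[i] :=
  if `[< single_layer_invertible alpha >] then
    xget (fun=> 0) [set phi | L2 bdD phi /\ ae_eq_on bdD (single_layer alpha phi) f]
  else fun=> 0.

Definition bd_indic (j : 'I_N) : T -> R[i] := fun x => (\1_(boundary (D j)) x)%:C.

Definition capacitance alpha : 'M[R[i]]_N :=
  \matrix_(i, j)
    - cintegral sigma (boundary (D i)) (single_layer_inv alpha (bd_indic j)).

End capacitance.

Section modulation.
Context {R : realType} {N : nat}.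

Definition periodic (T : R) (f : R -> R) := forall t, f (t + T) = f t.

Definition trig_polynomial (T : R) (f : R -> R) :=
  exists (m : nat) (c : int -> R[i]), forall t,
    (f t)%:C = \sum_(k < m.*2.+1)
      c (k%:Z - m%:Z) * expi ((k%:Z - m%:Z)%:~R * (2 * pi / T) * t).

Definition modulation (T : R) (f : R -> R) :=
  [/\ forall t, 0 < f t, periodic T f & trig_polynomial T (fun t => (f t)^-1)].

Definition modulated_matrix (vol : 'I_N -> R) (delta kappa_r rho_r : R)
    (rho kappa : 'I_N -> R -> R) (C : 'M[R[i]]_N) (t : R) : 'M[R[i]]_N :=
  let W1 := diag_mx (\row_i (Num.sqrt (kappa i t) * rho i t / vol i)%:C) in
  let W2 := diag_mx (\row_i (Num.sqrt (kappa i t) / rho i t)%:C) in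
  let W3 := diag_mx (\row_i (Num.sqrt (kappa i t) / 2 *
    derive1 (fun u => derive1 (kappa i) u / kappa i u `^ (3 / 2)) t)%:C) in
  (delta * kappa_r / rho_r)%:C *: (W1 *m C *m W2) + W3.

Definition is_solution (M : R -> 'M[R[i]]_N) (phi : R -> 'cV[R[i]]_N) :=
  (forall i t, cderivable (fun u => phi u i 0) t /\
               cderivable (cderive (fun u => phi u i 0)) t) /\
  (forall t, \col_i cderive (cderive (fun u => phi u i 0)) t + M t *m phi t = 0).

(* The quasifrequencies live in C / Omega Z, Omega = 2 pi / T: this set of
   representatives is invariant under translations by Omega Z. *)
Definition quasifrequencies (T : R) (M : R -> 'M[R[i]]_N) : set R[i] :=
  [set w | exists phi : R -> 'cV[R[i]]_N,
    [/\ is_solution M phi, exists t, phi t != 0 &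
        forall t, phi (t + T) = cexp ('i%C * w * T%:C) *: phi t]].

End modulation.

(* Main.v *)
From HB Require Import structures.
Require Import Defs.
From mathcomp Require Import all_boot all_order all_algebra.
From mathcomp Require Import complex ring lra.
From mathcomp Require Import all_classical all_reals all_analysis measurable_realfun.

(** Since [G^{-alpha}] is the complex conjugate of [G^alpha], the capacitance matrix
    at [-alpha] is the entrywise conjugate of the one at [alpha]. Moreover
    [G^alpha (y, x)] is the conjugate of [G^alpha (x, y)], so the single layer
    operator is symmetric for the sesquilinear pairing of [L^2]. Applied to the
    densities [psi_i] and [psi_j] this gives [C_ij = (C_ji)^*], unless column [i] or
    column [j] vanishes because the density does not exist. Hence for one or two
    resonators there is an invertible constant diagonal matrix [U] with
    [U C^alpha = C^{-alpha} U]. It commutes with the diagonal modulations, so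
    [phi -> U phi] maps the solutions at [alpha] onto those at [-alpha], with the same
    quasifrequencies.

    The pairing rests on Fubini's theorem, which needs two precautions. The kernel is
    jointly measurable because closed sets are Caratheodory-measurable for the
    Hausdorff measure, a metric outer measure. And as the kernel is only known to act
    boundedly on [L^2], one of the two functions is truncated first, and the
    truncation is removed by continuity in [L^2]; the surface measure is made
    sigma-finite by restricting it to the support of the two functions. *)

Set Implicit Arguments.
Unset Strict Implicit.
Unset Printing Implicit Defensive.

Import Order.TTheory GRing.Theory Num.Theory.
Import numFieldNormedType.Exports.

Local Open Scope classical_set_scope.
Local Open Scope complex_scope.
Local Open Scope ring_scope.

(** * Closed sets are measurable for the Hausdorff measure *)

Section metric_outer_measure.
Context {R : realType} {T : pseudoMetricType R}.
Variable mu : {outer_measure set T -> \bar R}.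
Implicit Types A B F X : set T.

Definition separated_by (e : R) A B := forall x y, A x -> B y -> ~ ball x e y.

Hypothesis mu_separated : forall (e : R) A B, 0 < e -> separated_by e A B ->
  (mu A + mu B <= mu (A `|` B))%E.

Section closed_set.
Variables (F X : set T).

Let far (n : nat) : set T := X `&` [set x | forall y, F y -> ~ ball y n.+1%:R^-1 x].

Let ring (n : nat) : set T := far n.+1 `\` far n.

Let far_mono m n : (m <= n)%N -> far m `<=` far n.
Proof.
move=> mn x [Xx Fx]; split=> // y Fy yx; apply: (Fx y Fy).
by apply: le_ball yx; rewrite lef_pV2 ?posrE ?ltr0n// ler_nat.
Qed.

Let inv_step n : 0 < n.+1%:R^-1 - n.+2%:R^-1 :> R.
Proof. by rewrite subr_gt0 ltf_pV2 ?posrE ?ltr0n// ltr_nat. Qed.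

Let far_near m n A B : (m < n)%N -> A `<=` far m ->
  B `<=` X `\` far n -> separated_by (m.+1%:R^-1 - m.+2%:R^-1) A B.
Proof.
move=> mn Afar Bfar x z Ax Bz xz.
have [Xz /not_andP[//|]] := Bfar _ Bz.
rewrite -existsNE => -[y /not_implyP[Fy /contrapT yz]].
have [_ /(_ y Fy)] := Afar _ Ax; apply.
have zx := ball_sym xz.
have yz' : ball y (m.+2%:R^-1) z.
  by apply: le_ball yz; rewrite lef_pV2 ?posrE ?ltr0n// ler_nat.
by have := ball_triangle yz' zx; rewrite addrC subrK.
Qed.

Let mu_far_ring m n : (m < n)%N -> (mu (far m) + mu (ring n) <= mu (far n.+1))%E.
Proof.
move=> mn; apply: (@le_trans _ _ (mu (far m `|` ring n))).
  apply: (mu_separated (inv_step m)); apply: (far_near mn) => //.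
  by move=> x [[Xx _] ?].
apply: le_outer_measure => x [|[]//].
by apply: far_mono; rewrite ltnW// ltnS ltnW.
Qed.

Let sum_ring b p : (\sum_(0 <= i < p) mu (ring (i.*2 + b).+1) <= mu (far (p.*2 + b)))%E.
Proof.
elim: p => [|p IH]; first by rewrite big_geq// outer_measure_ge0.
rewrite big_nat_recr//= (le_trans (leeD2r _ IH))// doubleS !addSn.
exact: mu_far_ring.
Qed.

Hypothesis Xfin : (mu X < +oo)%E.

Let sum_ring_fin : (\sum_(0 <= i <oo) mu (ring i) < +oo)%E.
Proof.
have far_le n : (mu (far n) <= mu X)%E by apply: le_outer_measure => x [].
apply: (@le_lt_trans _ _ (mu X + (mu X + mu X))%E); last by rewrite !lte_add_pinfty.
have mu0 i : (0 <= mu (ring i))%E by exact: outer_measure_ge0.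
apply: lime_le; first exact: is_cvg_nneseries.
apply: nearW => n; apply: (@le_trans _ _ (\sum_(0 <= i < n.*2.+1) mu (ring i))%E).
  rewrite [leRHS](@big_cat_nat _ _ _ n)//=; last first.
    by rewrite -addnn -addnS leq_addr.
  by rewrite leeDl// sume_ge0.
rewrite big_nat_recl//; apply: leeD.
  by apply: le_outer_measure => x [[]].
have -> : (\sum_(0 <= i < n.*2) mu (ring i.+1) =
    \sum_(0 <= i < n) mu (ring (i.*2 + 0).+1) + \sum_(0 <= i < n) mu (ring (i.*2 + 1).+1))%E.
  elim: n => [|n IH]; first by rewrite !big_geq// adde0.
  by rewrite doubleS !big_nat_recr//= IH addn0 addn1 -addeA; rewrite addeACA addeA.
by apply: leeD; apply: (le_trans (sum_ring _ _)).
Qed.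

Lemma closed_split : closed F -> (mu (X `&` F) + mu (X `&` ~` F) <= mu X)%E.
Proof.
move=> clF.
have cover n : X `&` ~` F `<=` far n `|` \bigcup_(i in ~` `I_n) ring i.
  move=> x [Xx Fx].
  have [m xm] : exists m, far m x.
    have := closed_openC clF; rewrite openE => /(_ x Fx)/nbhs_ballP[e /= e0 eF].
    have [m] := ltr_add_invr e0; rewrite add0r => me.
    exists m; split=> // y Fy /ball_sym yx; apply: (eF y) => //.
    exact: le_ball (ltW me) _ yx.
  have [nx|nx] := pselect (far n x); [by left|right].
  have ex : exists m, `[< far m x >] by exists m; apply/asboolP.
  have := ex_minnP ex; case=> -[|k] /asboolP xk kmin.
    by exfalso; apply: nx; apply: far_mono xk.
  have nk : ~ far k x by move=> /asboolP/kmin; rewrite ltnn.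
  exists k => //=; apply/negP; rewrite -leqNgt leqNgt; apply/negP => kn.
  by apply: nx; apply: far_mono xk.
apply/lee_addgt0Pr => e e0.
have := nneseries_tail_cvg sum_ring_fin (fun k _ => outer_measure_ge0 mu (ring k)).
move=> /fine_cvgP[fin /cvgrPdist_le/(_ e e0)] H.
near \oo => n.
have tail : (\sum_(n <= i <oo) mu (ring i) <= e%:E)%E.
  rewrite -(@fineK _ (\sum_(n <= i <oo) mu (ring i))%E); last by near: n.
  rewrite lee_fin; apply: (le_trans (ler_norm _)).
  by rewrite -normrN -sub0r; near: n.
apply: (@le_trans _ _ (mu (X `&` F) + (mu (far n) + \sum_(n <= i <oo) mu (ring i)))%E).
  apply: leeD2l; apply: (le_trans (le_outer_measure mu _ _ (cover n))).
  apply: (le_trans (outer_measureU2 _ _ _)); apply: leeD2l.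
  exact: outer_measure_sigma_subadditive_tail.
rewrite addeA; apply: leeD => //.
rewrite addeC (le_trans (mu_separated (inv_step n) _))//.
  apply: (@far_near n n.+1) => // x [Xx Fx]; split=> // -[_ /(_ x Fx)]; apply.
  by apply: ballxx; rewrite invr_gt0.
by apply: le_outer_measure => x [[]|[]].
Unshelve. all: by end_near. Qed.

End closed_set.

Lemma closed_caratheodory F : closed F -> mu.-caratheodory F.
Proof.
move=> clF; apply: le_caratheodory_measurable => X.
have [Xfin|] := ltP (mu X) +oo%E; first exact: closed_split.
by rewrite leye_eq => /eqP ->; rewrite leey.
Qed.

End metric_outer_measure.

Section hausdorff_borel.
Context {R : realType} {d : nat}.
Implicit Types A B C F : set 'rV[R]_d.

Lemma enorm_ball (x y : 'rV[R]_d) e : enorm (x - y) < e -> ball x e y.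
Proof.
move=> xye; split; first by apply: le_lt_trans xye; exact: sqrtr_ge0.
move=> i k; rewrite ord1; apply: le_lt_trans xye.
rewrite -sqrtr_sqr ler_sqrt; last first.
  by apply: sumr_ge0 => j _; rewrite -expr2 sqr_ge0.
rewrite /dot (bigD1 k)//= !mxE -expr2 lerDl; apply: sumr_ge0 => j _.
by rewrite -expr2 sqr_ge0.
Qed.

Lemma diam_ge0 A : (0 <= diam A)%E.
Proof. by apply: ereal_sup_ubound; left. Qed.

Lemma le_diam A B : A `<=` B -> (diam A <= diam B)%E.
Proof.
move=> AB; apply: ge_ereal_sup => _ [->|[[x y] [/= Ax Ay] <-]]; first exact: diam_ge0.
by apply: ereal_sup_ubound; right; exists (x, y) => //; split; exact: AB.
Qed.

Lemma enorm_le_diam A x y : A x -> A y -> ((enorm (x - y))%:E <= diam A)%E.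
Proof. by move=> Ax Ay; apply: ereal_sup_ubound; right; exists (x, y). Qed.

Lemma ball_const_ge0 k : 0 <= ball_const k :> R.
Proof. by rewrite /ball_const; case: ifP => // _; rewrite divr_ge0// pi_ge0. Qed.

Lemma le_hausdorff_gauge k e A B : A `<=` B ->
  (hausdorff_gauge k e A <= hausdorff_gauge k e B)%E.
Proof.
move=> AB; rewrite {2}/hausdorff_gauge; case: asboolP => [B0|_].
  by rewrite B0 subset0 in AB; rewrite AB hausdorff_gauge0.
case: ifPn => [Be|_]; last by rewrite leey.
rewrite /hausdorff_gauge; case: asboolP => [_|_].
  by rewrite lee_fin mulr_ge0 ?ball_const_ge0// exprn_ge0// fine_ge0// diam_ge0.
rewrite (le_trans (le_diam AB) Be) lee_fin ler_wpM2l ?ball_const_ge0//.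
have diamfin C : (diam C <= e%:E)%E -> diam C \is a fin_num.
  by move=> Ce; rewrite ge0_fin_numE ?diam_ge0//; apply: le_lt_trans Ce (ltry _).
rewrite lerXn2r// ?nnegrE ?fine_ge0 ?diam_ge0// fine_le//.
- by apply: diamfin; exact: le_trans (le_diam AB) Be.
- exact: diamfin.
- exact: le_diam.
Qed.

Lemma hausdorff_content_anti k e1 e2 A : e1 <= e2 ->
  (hausdorff_content k e2 A <= hausdorff_content k e1 A)%E.
Proof.
move=> e12; apply: le_ereal_inf_tmp => _ [F AF <-].
apply: (@le_trans _ _ (\sum_(0 <= j <oo) hausdorff_gauge k e2 (F j))%E).
  by apply: ereal_inf_lbound; exists F.
apply: lee_nneseries => [i _ _|i _]; first exact: hausdorff_gauge_ge0.
rewrite /hausdorff_gauge; case: asboolP => // _; case: ifPn => [F2|F2].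
  by case: ifP => // _; rewrite leey.
case: ifPn => // F1; exfalso; move/negP: F2; apply.
by rewrite (le_trans F1)// lee_fin.
Qed.

Lemma hausdorff_gauge_separated k e A B F : 0 < e -> separated_by e A B ->
  (hausdorff_gauge k (e / 2) (F `&` A) + hausdorff_gauge k (e / 2) (F `&` B) <=
   hausdorff_gauge k (e / 2) F)%E.
Proof.
move=> e0 sAB.
have [->|/set0P[x [Fx Ax]]] := eqVneq (F `&` A) set0.
  by rewrite hausdorff_gauge0 add0e le_hausdorff_gauge.
have [->|/set0P[y [Fy By]]] := eqVneq (F `&` B) set0.
  by rewrite hausdorff_gauge0 adde0 le_hausdorff_gauge.
rewrite {3}/hausdorff_gauge; case: asboolP => [F0|_]; first by rewrite F0 in Fx.
case: ifPn => [Fe|_]; last by rewrite leey.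
exfalso; apply: (sAB x y Ax By); apply: enorm_ball.
have := le_trans (enorm_le_diam Fx Fy) Fe; rewrite lee_fin => xye.
by apply: (le_lt_trans xye); rewrite ltr_pdivrMr// ltr_pMr// ltr1n.
Qed.

Lemma hausdorff_separated k e A B : 0 < e -> separated_by e A B ->
  (hausdorff k A + hausdorff k B <= hausdorff k (A `|` B))%E.
Proof.
move=> e0 sAB.
have content_le h : 0 < h <= e -> (hausdorff_content k (h / 2) A +
    hausdorff_content k (h / 2) B <= hausdorff k (A `|` B))%E.
  move=> /andP[h0 he].
  have sh : separated_by h A B by move=> x y Ax By /(le_ball he); exact: sAB.
  apply: (@le_trans _ _ (hausdorff_content k (h / 2) (A `|` B))); last first.
    by apply: hausdorff_content_le; rewrite divr_gt0.
  apply: le_ereal_inf_tmp => _ [F ABF <-].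
  apply: (@le_trans _ _ (\sum_(0 <= j <oo) (hausdorff_gauge k (h / 2) (F j `&` A) +
      hausdorff_gauge k (h / 2) (F j `&` B)))%E).
    rewrite nneseriesD; try by move=> *; exact: hausdorff_gauge_ge0.
    apply: leeD; apply: ereal_inf_lbound.
      exists (fun j => F j `&` A) => //= x Ax.
      by have [j _ Fj] := ABF x (or_introl Ax); exists j.
    exists (fun j => F j `&` B) => //= x Bx.
    by have [j _ Fj] := ABF x (or_intror Bx); exists j.
  apply: lee_nneseries => [i _ _|i _]; last exact: hausdorff_gauge_separated.
  by rewrite adde_ge0// hausdorff_gauge_ge0.
have content_ge0 C h : (0 <= hausdorff_content k h C)%E.
  by rewrite hausdorff_contentE; apply: mu_ext_ge0 => X; exact: hausdorff_gauge_ge0.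
have content2_le h1 h2 : 0 < h1 -> 0 < h2 -> (hausdorff_content k h1 A +
    hausdorff_content k h2 B <= hausdorff k (A `|` B))%E.
  move=> h10 h20; pose h := Num.min e (Num.min h1 h2).
  have h0 : 0 < h by rewrite !lt_min e0 h10.
  have half : h / 2 <= h by rewrite ler_pdivrMr// mulr_natr mulr2n lerDl ltW.
  apply: le_trans (content_le h _); last by rewrite h0 ge_min lexx.
  apply: leeD; apply: hausdorff_content_anti; apply: (le_trans half).
    by rewrite !ge_min lexx orbT.
  by rewrite !ge_min lexx !orbT.
have [H|] := ltP (hausdorff k (A `|` B)) +oo%E; last first.
  by rewrite leye_eq => /eqP ->; rewrite leey.
have fin C : C `<=` A `|` B -> hausdorff k C \is a fin_num.
  move=> CAB; rewrite ge0_fin_numE ?hausdorff_ge0//.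
  by apply: le_lt_trans H; exact: le_hausdorff.
have finB h : 0 < h -> hausdorff_content k h B \is a fin_num.
  move=> h0; rewrite ge0_fin_numE//; apply: le_lt_trans (hausdorff_content_le _ _ h0) _.
  by rewrite -ge0_fin_numE ?hausdorff_ge0// fin// => x; right.
have finA : hausdorff k A \is a fin_num by apply: fin => x; left.
rewrite addeC -leeBrDr//.
apply: ge_ereal_sup => _ [h2 h20 <-]; rewrite leeBrDr//.
rewrite addeC -leeBrDr ?finB//.
by apply: ge_ereal_sup => _ [h1 h10 <-]; rewrite leeBrDr ?finB// content2_le.
Qed.

Local Notation T := (surface_space R d).

Lemma closed_surface_measurable F : closed F -> measurable (F : set T).
Proof.
move=> clF; apply: (@closed_caratheodory R _ (surface_outer R d)) clF.
by move=> e A B e0; exact: hausdorff_separated.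
Qed.

Lemma measurable_coord (k : 'I_d) : measurable_fun setT (fun x : T => x 0 k).
Proof.
refine (@measurability _ _ _ _ _ _ (@RGenCInfty.G R) _ _); first exact: RGenCInfty.measurableE.
move=> _ [_ [a ->] <-]; rewrite setTI.
apply: closed_surface_measurable.
rewrite (_ : _ @^-1` _ = (fun x : 'rV[R]_d => x 0 k) @^-1` [set y | a <= y]); last first.
  by apply/seteqP; split=> x /=; rewrite in_itv/= andbT.
apply: closed_comp; last exact: closed_ge.
by move=> x _; exact: coord_continuous.
Qed.

End hausdorff_borel.

(** * Integral operators on square integrable functions *)

Section measurable_limn.
Context d (T : measurableType d) (R : realType).

Lemma limn_esup_cvgP (u : R ^nat) : cvgn u <->
  limn_esup (EFin \o u) = limn_einf (EFin \o u) /\ limn_esup (EFin \o u) \is a fin_num.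
Proof.
split=> [ucv|[eqe fin]].
  have : (EFin \o u) @ \oo --> (limn u)%:E by apply: cvg_EFin => //; exact: nearW.
  by move=> /cvg_limn_einf_sup[-> ->].
have : (EFin \o u) @ \oo --> limn_esup (EFin \o u).
  apply: (@squeeze_cvge _ _ _ _ (einfs (EFin \o u)) _ (esups (EFin \o u))).
  - apply: nearW => n; apply/andP; split; last by apply: ereal_sup_ubound; exists n => /=.
    by apply: ereal_inf_lbound; exists n => /=.
  - by rewrite eqe limn_einf_lim; exact: is_cvg_einfs.
  - by rewrite limn_esup_lim; exact: is_cvg_esups.
by rewrite -(fineK fin) => /fine_cvg ul; apply/cvg_ex; eexists; exact: ul.
Qed.

Lemma limn_cvg_esup (u : R ^nat) : cvgn u -> limn u = fine (limn_esup (EFin \o u)).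
Proof.
move=> ucv; have : (EFin \o u) @ \oo --> (limn u)%:E.
  by apply: cvg_EFin => //; exact: nearW.
by move=> /cvg_limn_einf_sup[_ ->].
Qed.

Lemma limn_dvg (u : R ^nat) : ~ cvgn u -> limn u = 0.
Proof.
move=> ucv; rewrite /lim; apply: xgetPN => l ul.
by apply: ucv; apply/cvg_ex; exists l.
Qed.

Lemma measurable_fun_limn (u : (T -> R) ^nat) :
  (forall n, measurable_fun setT (u n)) ->
  measurable_fun setT (fun x => limn (u ^~ x)).
Proof.
move=> mu.
have meu n : measurable_fun setT (EFin \o u n) by exact/measurable_EFinP.
have msup : measurable_fun setT (fun x => limn_esup (EFin \o u ^~ x)).
  exact: (measurable_fun_limn_esup meu).
have minf : measurable_fun setT (fun x => limn_einf (EFin \o u ^~ x)).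
  have meuN n : measurable_fun setT (fun x => (- (u n x)%:E)%E).
    exact: (measurableT_comp (@oppe_measurable R setT) (meu n)).
  exact: (measurableT_comp (@oppe_measurable R setT) (measurable_fun_limn_esup meuN)).
pose C := [set x | cvgn (u ^~ x)].
have mC : measurable C.
  have -> : C = (setT `&` [set x | limn_esup (EFin \o u ^~ x) = limn_einf (EFin \o u ^~ x)])
      `&` (setT `&` [set x | limn_esup (EFin \o u ^~ x) \is a fin_num]).
    by rewrite !setTI; apply/seteqP; split=> x /limn_esup_cvgP.
  by apply: measurableI; [exact: measurable_eqe|exact: emeasurable_fin_num].
rewrite (_ : (fun x => _) = (fun x => fine (limn_esup (EFin \o u ^~ x)) * \1_C x)).
  apply: measurable_funM; last exact: measurable_indic.
  exact: (measurableT_comp (@fine_measurable R setT measurableT) msup).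
apply/funext => x; rewrite indicE; case: (boolP (x \in C)) => xC.
  by rewrite mulr1 limn_cvg_esup// ; rewrite inE in xC.
by rewrite mulr0 limn_dvg//; move/negP: xC; rewrite inE.
Qed.
End measurable_limn.

Section total_Rintegral.
Context d (T : measurableType d) (R : realType) (mu : {measure set T -> \bar R}).
Variables (D : set T) (mD : measurable D).
Implicit Types f g : T -> R.

Lemma Rintegral_not_integrable f : measurable_fun D f ->
  ~ mu.-integrable D (EFin \o f) -> \int[mu]_(x in D) f x = 0.
Proof.
move=> mf nf; have mEf : measurable_fun D (EFin \o f) by exact/measurable_EFinP.
rewrite /Rintegral integralE.
have := @integral_ge0 _ _ _ mu D _ (fun x _ => funepos_ge0 (EFin \o f) x).
have := @integral_ge0 _ _ _ mu D _ (fun x _ => funeneg_ge0 (EFin \o f) x).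
case En : (\int[mu]_(x in D) (EFin \o f)^\- x)%E => [n| |]//;
  case Ep : (\int[mu]_(x in D) (EFin \o f)^\+ x)%E => [p| |]// _ _.
exfalso; apply: nf; apply/integrableP; split=> //.
rewrite (_ : (fun x => _) = ((EFin \o f)^\+ \+ (EFin \o f)^\-)%E); last first.
  by rewrite -fune_abse.
rewrite ge0_integralD//.
- by rewrite Ep En -EFinD ltry.
- exact: measurable_funepos.
- exact: measurable_funeneg.
Qed.

Lemma Rintegral_mull f r : measurable_fun D f ->
  \int[mu]_(x in D) (r * f x) = r * \int[mu]_(x in D) f x.
Proof.
move=> mf; have [->|r0] := eqVneq r 0.
  rewrite mul0r (@eq_Rintegral _ _ _ mu D (cst 0)); last by move=> x _; rewrite mul0r.
  by rewrite /Rintegral/= integral0.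
have [fi|fn] := pselect (mu.-integrable D (EFin \o f)); first exact: RintegralZl.
rewrite (Rintegral_not_integrable mf fn) mulr0 Rintegral_not_integrable//.
  by apply: measurable_funM => //; exact: measurable_cst.
move=> rfi; apply: fn.
have := integrableZl mD r^-1 rfi; apply: eq_integrable => // x _ /=.
by rewrite -EFinM mulKf.
Qed.

Lemma Rintegral_mulr f r : measurable_fun D f ->
  \int[mu]_(x in D) (f x * r) = \int[mu]_(x in D) f x * r.
Proof. by move=> mf; under eq_Rintegral do rewrite mulrC; rewrite Rintegral_mull// mulrC. Qed.

Lemma ae_eq_Rintegral f g : measurable_fun D f -> measurable_fun D g ->
  {ae mu, forall x, D x -> f x = g x} ->
  \int[mu]_(x in D) f x = \int[mu]_(x in D) g x.
Proof.
move=> mf mg fg; rewrite /Rintegral; congr fine; apply: ae_eq_integral => //.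
- exact/measurable_EFinP.
- exact/measurable_EFinP.
- by apply: filterS fg => x fg Dx /=; rewrite fg.
Qed.

Lemma Rintegral_fine (f : T -> \bar R) : mu.-integrable D f ->
  \int[mu]_(x in D) fine (f x) = fine (\int[mu]_(x in D) f x).
Proof.
move=> fi; rewrite /Rintegral; congr fine; apply: ae_eq_integral => //.
- apply/measurable_EFinP.
  exact: (measurableT_comp (@fine_measurable R setT measurableT) (measurable_int _ fi)).
- exact: measurable_int fi.
- by have := integrable_ae mD fi; apply: filterS => x fx Dx; rewrite fineK// fx.
Qed.

End total_Rintegral.

Section Rintegral_Fubini.
Context d (T : measurableType d) (R : realType).
Variable nu : {sigma_finite_measure set T -> \bar R}.
Variables (K : T -> T -> R) (f g : T -> R).
Hypotheses (mK : measurable_fun setT (fun z : T * T => K z.1 z.2))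
  (mf : measurable_fun setT f) (mg : measurable_fun setT g).

Lemma Rintegral_Fubini c : nu.-integrable setT (EFin \o g) ->
  (forall x, g x != 0 -> (\int[nu]_y (`|K x y * f y|)%:E <= c%:E)%E) ->
  \int[nu]_x (\int[nu]_y (K x y * f y) * g x) =
  \int[nu]_y (f y * \int[nu]_x (K x y * g x)).
Proof.
move=> gi Fc; pose h := fun z : T * T => K z.1 z.2 * f z.2 * g z.1.
have mh : measurable_fun setT h.
  apply: measurable_funM; first apply: measurable_funM => //.
    exact: (measurableT_comp mf measurable_snd).
  exact: (measurableT_comp mg measurable_fst).
have mEh : measurable_fun setT (EFin \o h) by exact/measurable_EFinP.
have mK1 x : measurable_fun setT (K x).
  exact: (measurableT_comp mK (measurable_pair1 x)).
have mK2 y : measurable_fun setT (K ^~ y).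
  exact: (measurableT_comp mK (measurable_pair2 y)).
have mbound : measurable_fun setT (EFin \o (fun x => c * `|g x|)).
  apply/measurable_EFinP; apply: measurable_funM => //.
  exact: (measurableT_comp (@normr_measurable R setT) mg).
have hi : ((nu \x nu)%E).-integrable setT (EFin \o h).
  apply/integrable12ltyP => //.
  apply: (@le_lt_trans _ _ (\int[nu]_x (c * `|g x|)%:E)%E).
    apply: ge0_le_integral => //.
    - by move=> x _; apply: integral_ge0.
    - apply: (measurable_fun_fubini_tonelli_F (abse \o (EFin \o h))) => [|z].
        exact: (measurableT_comp (@abse_measurable R setT) mEh).
      exact: abse_ge0.
    - move=> x _ /=; have [gx0|gx0] := eqVneq (g x) 0.
        rewrite /h/= gx0; under eq_integral do rewrite mulr0 normr0.
        by rewrite integral0 normr0 mulr0.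
      rewrite /h/=; under eq_integral do rewrite normrM EFinM.
      rewrite ge0_integralZr//; first by rewrite EFinM lee_wpmul2r// Fc.
      apply/measurable_EFinP; apply: (measurableT_comp (@normr_measurable R setT)).
      exact: measurable_funM.
  have gn := integrable_norm gi.
  apply: integrable_lty => //; apply: eq_integrable (integrableZl measurableT c gn) => //.
have /(congr1 fine) := Fubini hi.
have -> : \int[nu]_x (\int[nu]_y (K x y * f y) * g x) =
    \int[nu]_x fine (\int[nu]_y (EFin \o h) (x, y)).
  apply: eq_Rintegral => x _; rewrite -Rintegral_mulr//; exact: measurable_funM.
have -> : \int[nu]_y (f y * \int[nu]_x (K x y * g x)) =
    \int[nu]_y fine (\int[nu]_x (EFin \o h) (x, y)).
  apply: eq_Rintegral => y _; rewrite -Rintegral_mull//; last exact: measurable_funM.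
  by apply: eq_Rintegral => x _; rewrite /h/= mulrA (mulrC (f y)).
rewrite (Rintegral_fine measurableT (integrable_fubini_F hi)).
have hsi : ((nu \x nu)%E).-integrable setT (fun z => (EFin \o h) (z.2, z.1)).
  have ms : measurable_fun setT (fun z : T * T => (EFin \o h) (z.2, z.1)).
    apply: (measurableT_comp mEh).
    exact: (measurable_fun_pair measurable_snd measurable_fst).
  apply/integrable12ltyP => //.
  exact: (iffLR (integrable21ltyP _ _ mEh)).
by rewrite (Rintegral_fine measurableT (integrable_fubini_F hsi)).
Qed.
End Rintegral_Fubini.

Section restriction_to_support.
Context d (T : measurableType d) (R : realType) (mu : {measure set T -> \bar R}).

Lemma integral_support (A B : set T) (mA : measurable A) (h : T -> \bar R) :
  A `<=` B -> (forall x, ~ A x -> h x = 0%E) ->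
  (\int[mrestr mu mA]_x h x = \int[mu]_(x in B) h x)%E.
Proof.
move=> AB h0.
have hA C : A `<=` C -> h \_ C = h.
  move=> AC; apply/funext => x; rewrite patchE; case: ifPn => //.
  by move=> /negP; rewrite inE => nC; rewrite h0// => /AC.
have -> : (\int[mrestr mu mA]_x h x = \int[mrestr mu mA]_(x in A) h x)%E.
  by rewrite [RHS]integral_mkcond hA.
rewrite (eq_measure_integral mu); last first.
  move=> C _ CA; rewrite /= /mrestr (_ : C `&` A = C)//.
  by apply/seteqP; split=> [x []//|x Cx]; split=> //; exact: CA.
by rewrite integral_mkcond [RHS]integral_mkcond !hA.
Qed.

Lemma sigma_finite_support (p : T -> R) (mA : measurable [set x | p x != 0]) :
  (forall x, 0 <= p x) -> mu.-integrable setT (EFin \o p) ->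
  sigma_finite setT (mrestr mu mA).
Proof.
move=> p0 pi; have /measurable_EFinP mp := measurable_int _ pi.
pose E n := [set x | n.+1%:R^-1 <= p x].
have mE n : measurable (E n).
  rewrite (_ : E n = setT `&` p @^-1` `[n.+1%:R^-1, +oo[%classic); first exact: mp.
  by rewrite setTI; apply/seteqP; split=> x; rewrite /E/= in_itv/= andbT.
exists (fun n => ~` [set x | p x != 0] `|` E n).
  apply/seteqP; split=> // x _; have [px|px] := pselect (p x != 0).
    have px0 : 0 < p x by rewrite lt_def px p0.
    have [m] := ltr_add_invr px0; rewrite add0r => mpx.
    by exists m => //; right; rewrite /E/= ltW.
  by exists 0%N => //; left.
move=> n; split; first by apply: measurableU => //; exact: measurableC.
rewrite /mrestr setIUl setICl set0U.
apply: (@le_lt_trans _ _ (mu (E n))).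
  by apply: le_measure; rewrite ?inE; [exact: measurableI|exact: mE|exact: subIsetl].
have ppos : (0 < n.+1%:R :> R) by rewrite ltr0n.
have : (\int[mu]_(x in E n) cst (n.+1%:R^-1)%:E x <= \int[mu]_x (p x)%:E)%E.
  apply: (@le_trans _ _ (\int[mu]_(x in E n) (p x)%:E)%E).
    apply: ge0_le_integral => //.
    - by move=> x _; rewrite lee_fin.
    - exact: measurable_funTS (measurable_int _ pi).
  apply: ge0_subset_integral => //; first exact: measurable_int pi.
  by move=> x _; rewrite lee_fin.
rewrite integral_cst// => H.
rewrite -(@lte_pmul2l _ (n.+1%:R^-1)%:E)// ?lte_fin ?invr_gt0//.
rewrite gt0_muley ?lte_fin ?invr_gt0//; apply: le_lt_trans H _.
by have /integrable_fin_num := pi => /(_ measurableT); rewrite fin_numElt => /andP[].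
Qed.

End restriction_to_support.

Section pairing.
Context d (T : measurableType d) (R : realType) (mu : {measure set T -> \bar R}).
Variables (B : set T) (mB : measurable B) (K : T -> T -> R).
Hypothesis mK : measurable_fun setT (fun z : T * T => K z.1 z.2).
Implicit Types f g p : T -> R.

Let mK1 x : measurable_fun setT (K x).
Proof. exact: (measurableT_comp mK (measurable_pair1 x)). Qed.

(* [K x y * f y * g x] need not be integrable on the product: [g_ n] cuts [g] down
   to where [1/|g|] and [\int |K x y * f y| dy] are at most about [n]. *)
Lemma truncated_pairing f g : measurable_fun setT f -> measurable_fun setT g ->
  (forall x, ~ B x -> f x = 0) -> (forall x, ~ B x -> g x = 0) ->
  mu.-integrable setT (fun x => (f x ^+ 2)%:E) ->
  mu.-integrable setT (fun x => (g x ^+ 2)%:E) ->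
  exists g_ : nat -> T -> R,
  [/\ forall n, measurable_fun setT (g_ n),
      forall n x, g_ n x = 0 \/ g_ n x = g x,
      forall x, mu.-integrable B (fun y => (K x y * f y)%:E) ->
        \forall n \near \oo, g_ n x = g x &
      forall n, \int[mu]_(x in B) (\int[mu]_(y in B) (K x y * f y) * g_ n x) =
        \int[mu]_(y in B) (f y * \int[mu]_(x in B) (K x y * g_ n x))].
Proof.
move=> mf mg f0 g0 if2 ig2.
pose p x := f x ^+ 2 + g x ^+ 2.
have p0 x : 0 <= p x by rewrite addr_ge0// sqr_ge0.
have ip : mu.-integrable setT (EFin \o p).
  exact: (integrableD measurableT if2 ig2).
have mp : measurable_fun setT p by exact/measurable_EFinP/(measurable_int _ ip).
pose A := [set x | p x != 0].
have mA : measurable A.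
  rewrite (_ : A = setT `&` p @^-1` [set~ 0]).
    by apply: mp => //; apply: measurableC; exact: measurable_set1.
  by rewrite setTI; apply/seteqP; split=> x /eqP.
have pE x : p x = 0 -> f x = 0 /\ g x = 0.
  move=> /eqP; rewrite paddr_eq0 ?sqr_ge0// !sqrf_eq0 => /andP[/eqP ? /eqP ?].
  by split.
have nAE x : ~ A x -> f x = 0 /\ g x = 0 by move=> /negP; rewrite negbK => /eqP/pE.
have AB : A `<=` B.
  move=> x /= /eqP px; apply: contrapT => nB; apply: px.
  by rewrite /p f0// g0// expr0n/= addr0.
have hs : sigma_finite setT (mrestr mu mA) := sigma_finite_support mA p0 ip.
pose nu : {sigma_finite_measure set T -> \bar R} :=
  HB.pack (mrestr mu mA) (Measure_isSigmaFinite.Build d T R (mrestr mu mA) hs).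
have nuE h : (forall x, ~ A x -> h x = 0%E) ->
    (\int[nu]_x h x = \int[mu]_(x in B) h x)%E by exact: integral_support.
have nuRE (h : T -> R) : (forall x, ~ A x -> h x = 0) ->
    \int[nu]_x h x = \int[mu]_(x in B) h x.
  by move=> h0; rewrite /Rintegral nuE// => x /h0 ->.
pose F x := (\int[nu]_y (`|K x y * f y|)%:E)%E.
have mF : measurable_fun setT F.
  apply: (measurable_fun_fubini_tonelli_F
      (fun z : T * T => (`|K z.1 z.2 * f z.2|)%:E)) => [|z]; last by rewrite lee_fin.
  apply/measurable_EFinP; apply: (measurableT_comp (@normr_measurable R setT)).
  by apply: measurable_funM => //; exact: (measurableT_comp mf measurable_snd).
pose S n := [set x | (F x <= n%:R%:E)%E] `&` [set x | n.+1%:R^-1 <= `|g x|].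
have mS n : measurable (S n).
  apply: measurableI.
    rewrite (_ : [set x | _] = setT `&` F @^-1` `]-oo, n%:R%:E]%classic).
      by apply: mF => //; exact: emeasurable_itv.
    by rewrite setTI; apply/seteqP; split=> x; rewrite /= in_itv.
  have mng : measurable_fun setT (Num.norm \o g).
    exact: (measurableT_comp (@normr_measurable R setT) mg).
  rewrite (_ : [set x | _] = setT `&` (Num.norm \o g) @^-1` `[n.+1%:R^-1, +oo[%classic).
    exact: mng.
  by rewrite setTI; apply/seteqP; split=> x; rewrite /= in_itv/= andbT.
pose g_ n x := g x * \1_(S n) x.
have mg_ n : measurable_fun setT (g_ n).
  by apply: measurable_funM => //; exact: measurable_indic.
have g_E n x : g_ n x = 0 \/ g_ n x = g x.
  by rewrite /g_ indicE; case: (x \in S n); rewrite ?mulr1 ?mulr0; [right|left].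
exists g_; split=> //.
- move=> x Kfi; have [gx0|gx0] := eqVneq (g x) 0.
    by apply: nearW => n; rewrite /g_ gx0 mul0r.
  have ngx : 0 < `|g x| by rewrite normr_gt0.
  have [m1 m1g] := ltr_add_invr ngx; rewrite add0r in m1g.
  have Ffin : (F x < +oo)%E.
    rewrite /F nuE; last by move=> y /nAE[-> _]; rewrite mulr0 normr0.
    by move/integrableP: Kfi => [_].
  have F0 : (0 <= F x)%E by apply: integral_ge0 => y _; rewrite lee_fin.
  have [m2 Fm2] : exists m2, (F x <= m2%:R%:E)%E.
    exists (Num.truncn (fine (F x))).+1; rewrite -(@fineK _ (F x)) ?ge0_fin_numE//.
    by rewrite lee_fin ltW// truncnS_gt.
  exists (maxn m1 m2) => // n /=; rewrite geq_max => /andP[m1n m2n].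
  rewrite /g_ indicE mem_set ?mulr1//; split=> /=.
    by apply: (le_trans Fm2); rewrite lee_fin ler_nat.
  by apply: le_trans (ltW m1g); rewrite lef_pV2 ?posrE// ler_nat.
- move=> n.
  have g_0 x : ~ A x -> g_ n x = 0 by move=> /nAE[_]; rewrite /g_ => ->; rewrite mul0r.
  have ig_ : nu.-integrable setT (EFin \o g_ n).
    apply/integrableP; split; first exact/measurable_EFinP.
    rewrite nuE; last by move=> x /g_0 /= ->; rewrite normr0.
    have mi : mu.-integrable setT (EFin \o g_ n).
      apply: (le_integrable measurableT _ _ (integrableZl measurableT n.+1%:R ig2)).
        exact/measurable_EFinP.
      move=> x _; rewrite /= lee_fin /g_ indicE.
      have [|] := boolP (x \in S n); last by rewrite mulr0 normr0.
      rewrite inE mulr1 => -[_ /= gx]; rewrite normrM normrX (ger0_norm (ler0n _ _)).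
      rewrite expr2 mulrA ler_peMl// -ler_pdivrMl ?ltr0n// mulr1.
      done.
    by have /integrableP[] := integrableS measurableT mB (@subsetT _ B) mi.
  have Fc x : g_ n x != 0 -> (\int[nu]_y (`|K x y * f y|)%:E <= n%:R%:E)%E.
    rewrite /g_ indicE; have [|] := boolP (x \in S n); last by rewrite mulr0 eqxx.
    by rewrite inE => -[].
  have := Rintegral_Fubini mK mf (mg_ n) ig_ Fc.
  rewrite nuRE; last by move=> x /g_0 ->; rewrite mulr0.
  rewrite nuRE; last by move=> x /nAE[-> _]; rewrite mul0r.
  have -> : \int[mu]_(x in B) (\int[nu]_y (K x y * f y) * g_ n x) =
      \int[mu]_(x in B) (\int[mu]_(y in B) (K x y * f y) * g_ n x).
    by apply: eq_Rintegral => x _; rewrite nuRE// => y /nAE[-> _]; rewrite mulr0.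
  move=> ->; apply: eq_Rintegral => y _; rewrite nuRE// => x /g_0 ->.
  by rewrite mulr0.
Qed.

End pairing.

Section square_integrable.
Context d (T : measurableType d) (R : realType) (mu : {measure set T -> \bar R}).
Variables (B : set T) (mB : measurable B).
Implicit Types p q : T -> R.

Definition sqint p :=
  measurable_fun B p /\ mu.-integrable B (fun x => (p x ^+ 2)%:E).

Lemma le_sqint p q : measurable_fun B p ->
  mu.-integrable B (EFin \o q) -> (forall x, B x -> p x ^+ 2 <= q x) -> sqint p.
Proof.
move=> mp iq pq; split=> //; apply: (le_integrable mB _ _ iq) => [|x Bx].
  by apply/measurable_EFinP; exact: measurable_funX.
rewrite lee_fin ger0_norm ?sqr_ge0//.
by apply: (le_trans (pq _ Bx)); exact: ler_norm.
Qed.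

Lemma eq_sqint p q : (forall x, B x -> p x = q x) -> sqint p -> sqint q.
Proof.
move=> pq [mp ip]; split.
  by apply: eq_measurable_fun mp => x; rewrite inE => /pq.
by apply: eq_integrable ip => // x; rewrite inE => /pq ->.
Qed.

Lemma sqintN p : sqint p -> sqint (fun x => - p x).
Proof.
move=> [mp ip]; split; first exact: measurableT_comp mp.
by apply: eq_integrable ip => // x _; rewrite sqrrN.
Qed.

Lemma sqintD p q : sqint p -> sqint q -> sqint (fun x => p x + q x).
Proof.
move=> [mp ip] [mq iq].
apply: (@le_sqint _ (fun x => 2 * (p x ^+ 2 + q x ^+ 2))).
- exact: measurable_funD.
- have := integrableZl mB 2 (integrableD mB ip iq).
  by apply: eq_integrable => // x _ /=; rewrite -EFinD -EFinM.
- move=> x _; rewrite -subr_ge0.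
  by rewrite (_ : _ - _ = (p x - q x) ^+ 2) ?sqr_ge0//; ring.
Qed.

Lemma sqintB p q : sqint p -> sqint q -> sqint (fun x => p x - q x).
Proof. by move=> ip /sqintN; exact: sqintD. Qed.

Lemma le_abs_mul_sqr (e a b : R) : 0 < e -> `|a * b| <= e * a ^+ 2 + e^-1 * b ^+ 2.
Proof.
move=> e0; rewrite normrM -(real_normK (num_real a)) -(real_normK (num_real b)).
move: `|a| `|b| (normr_ge0 a) (normr_ge0 b) => s t s0 t0.
rewrite -subr_ge0 (_ : _ - _ = e^-1 * ((e * s - t) ^+ 2 + e * s * t)); last by field; lra.
by apply: mulr_ge0; [rewrite invr_ge0 ltW|apply: addr_ge0; rewrite ?sqr_ge0// !mulr_ge0// ltW].
Qed.

Lemma sqint_mul p q : sqint p -> sqint q -> mu.-integrable B (fun x => (p x * q x)%:E).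
Proof.
move=> [mp ip] [mq iq]; apply: (le_integrable mB _ _ (integrableD mB ip iq)).
  by apply/measurable_EFinP; exact: measurable_funM.
move=> x _ /=; rewrite lee_fin [leRHS]ger0_norm ?addr_ge0 ?sqr_ge0//.
by have := le_abs_mul_sqr (p x) (q x) ltr01; rewrite invr1 !mul1r.
Qed.

Lemma le_Rintegral_mul p q e : 0 < e -> sqint p -> sqint q ->
  `|\int[mu]_(x in B) (p x * q x)| <=
  e * \int[mu]_(x in B) (p x ^+ 2) + e^-1 * \int[mu]_(x in B) (q x ^+ 2).
Proof.
move=> e0 ip iq; apply: (le_trans (le_normr_Rintegral mB (sqint_mul ip iq))).
rewrite -RintegralZl//; last by case: ip.
rewrite -RintegralZl//; last by case: iq.
have iep := integrableZl mB e ip.2; have ieq := integrableZl mB e^-1 iq.2.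
rewrite -RintegralD//; apply: le_Rintegral => //.
- by have := integrable_norm (sqint_mul ip iq).
- exact: (integrableD mB iep ieq).
- by move=> x _; exact: le_abs_mul_sqr.
Qed.

End square_integrable.

Section operator_pairing.
Context d (T : measurableType d) (R : realType) (mu : {measure set T -> \bar R}).
Variables (B : set T) (mB : measurable B) (K : T -> T -> R).
Hypothesis mK : measurable_fun setT (fun z : T * T => K z.1 z.2).
Implicit Types f g p : T -> R.

Let adj p y := \int[mu]_(x in B) (K x y * p x).

Variables (C : R).
Hypotheses (C0 : 0 <= C)
  (adj_int : forall p, sqint mu B p ->
    {ae mu, forall y, B y -> mu.-integrable B (fun x => (K x y * p x)%:E)})
  (adj_bounded : forall p, sqint mu B p -> sqint mu B (adj p) /\
    \int[mu]_(y in B) (adj p y ^+ 2) <= C * \int[mu]_(x in B) (p x ^+ 2)).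

Lemma adjB p q : sqint mu B p -> sqint mu B q ->
  {ae mu, forall y, B y -> adj (fun x => p x - q x) y = adj p y - adj q y}.
Proof.
move=> ip iq; have := adj_int ip; have := adj_int iq; apply: filterS2 => y + + By.
move=> /(_ By) Iq /(_ By) Ip; rewrite /adj -RintegralB//.
by apply: eq_Rintegral => x _; rewrite mulrBr.
Qed.

Lemma truncation_cvg g (g_ : nat -> T -> R) : sqint mu B g ->
  (forall n, measurable_fun B (g_ n)) ->
  (forall n x, g_ n x = 0 \/ g_ n x = g x) ->
  {ae mu, forall x, B x -> \forall n \near \oo, g_ n x = g x} ->
  (forall n, sqint mu B (fun x => g x - g_ n x)) /\
  forall e, 0 < e -> exists n, \int[mu]_(x in B) ((g x - g_ n x) ^+ 2) <= e.
Proof.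
move=> [mg ig] mg_ g_E g_g.
have le_g n x : (g x - g_ n x) ^+ 2 <= g x ^+ 2.
  by case: (g_E n x) => ->; rewrite ?subr0// subrr expr0n/= sqr_ge0.
have sq n : sqint mu B (fun x => g x - g_ n x).
  by apply: (le_sqint mB _ ig) => //; exact: measurable_funB.
split=> // e e0.
have [] := @dominated_convergence _ _ _ mu B mB
  (fun n x => ((g x - g_ n x) ^+ 2)%:E) (cst 0%E) (fun x => (g x ^+ 2)%:E) _ _ _ ig _.
- by move=> n; exact: measurable_int (sq n).2.
- exact: measurable_cst.
- apply: filterS g_g => x xg Bx; apply: cvg_near_cst.
  by apply: filterS (xg Bx) => n ->; rewrite subrr expr0n.
- apply: aeW => x n Bx.
  by rewrite /= lee_fin ger0_norm ?sqr_ge0.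
move=> _ _; rewrite integral0 => /fine_cvgP[_ /cvgrPdist_le/(_ e e0)[n _ /(_ n (leqnn n))]].
rewrite sub0r normrN => H; exists n; apply: le_trans H; exact: ler_norm.
Qed.

Lemma operator_pairing f g : sqint mu B f -> sqint mu B g ->
  {ae mu, forall x, B x -> mu.-integrable B (fun y => (K x y * f y)%:E)} ->
  sqint mu B (fun x => \int[mu]_(y in B) (K x y * f y)) ->
  \int[mu]_(x in B) (\int[mu]_(y in B) (K x y * f y) * g x) =
  \int[mu]_(y in B) (f y * adj g y).
Proof.
move=> sf sg Kf_int sKf.
have patchB h x : B x -> (h \_ B) x = h x :> R.
  by move=> Bx; rewrite patchE mem_set.
have patchN h x : ~ B x -> (h \_ B) x = 0 :> R.
  by move=> Bx; rewrite patchE memNset.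
have mpatch (h : T -> R) : measurable_fun B h -> measurable_fun setT (h \_ B).
  by move=> mh; have H := iffLR (measurable_restrictT h mB) mh; exact: H.
have ipatch h : sqint mu B h -> mu.-integrable setT (fun x => ((h \_ B) x ^+ 2)%:E).
  move=> [_ ih]; have /(integrable_mkcond _ mB) := ih; apply: eq_integrable => // x _.
  by rewrite !patchE; case: ifP => //; rewrite expr0n.
have [g_ [mg_ g_E g_g g_pair]] := truncated_pairing mB mK (mpatch _ sf.1)
  (mpatch _ sg.1) (patchN f) (patchN g) (ipatch _ sf) (ipatch _ sg).
have sg0 : sqint mu B (g \_ B) by apply: eq_sqint sg => // x Bx; rewrite patchB.
have [sD cD] : (forall n, sqint mu B (fun x => (g \_ B) x - g_ n x)) /\
    forall e, 0 < e -> exists n, \int[mu]_(x in B) (((g \_ B) x - g_ n x) ^+ 2) <= e.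
  apply: truncation_cvg => //.
    by move=> n; exact: measurable_funTS (mg_ n).
  apply: filterS Kf_int => x Kfx Bx; apply: g_g; apply: eq_integrable (Kfx Bx) => // y.
  by rewrite inE => By; rewrite patchB.
have sg_ n : sqint mu B (g_ n).
  apply: (eq_sqint mB _ (sqintB mB sg0 (sD n))) => x Bx /=; ring.
have {}g_pair n : \int[mu]_(x in B) (\int[mu]_(y in B) (K x y * f y) * g_ n x) =
    \int[mu]_(y in B) (f y * adj (g_ n) y).
  have E x : \int[mu]_(y in B) (K x y * (f \_ B) y) = \int[mu]_(y in B) (K x y * f y).
    by apply: eq_Rintegral => y; rewrite inE => By; rewrite patchB.
  have := g_pair n; under eq_Rintegral do rewrite E.
  by move=> ->; apply: eq_Rintegral => y; rewrite inE => By; rewrite patchB.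
have -> : \int[mu]_(x in B) (\int[mu]_(y in B) (K x y * f y) * g x) =
    \int[mu]_(x in B) (\int[mu]_(y in B) (K x y * f y) * (g \_ B) x).
  by apply: eq_Rintegral => x; rewrite inE => Bx; rewrite patchB.
have -> : \int[mu]_(y in B) (f y * adj g y) = \int[mu]_(y in B) (f y * adj (g \_ B) y).
  apply: eq_Rintegral => y _; congr (_ * _).
  by apply: eq_Rintegral => x; rewrite inE => Bx; rewrite patchB.
move: (g \_ B) sg0 sD cD => {sg g_E g_g g} g sg sD cD.
set Kf := fun x => \int[mu]_(y in B) (K x y * f y) in sKf g_pair *.
set c := LHS; set c' := RHS.
have [sAg _] := adj_bounded sg.
have cE n : c - c' = \int[mu]_(x in B) (Kf x * (g x - g_ n x)) -
    \int[mu]_(y in B) (f y * adj (fun x => g x - g_ n x) y).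
  have -> : \int[mu]_(x in B) (Kf x * (g x - g_ n x)) =
      c - \int[mu]_(x in B) (Kf x * g_ n x).
    rewrite -RintegralB//; try exact: sqint_mul.
    by apply: eq_Rintegral => x _; rewrite mulrBr.
  have [sAg_ _] := adj_bounded (sg_ n).
  have [sAD _] := adj_bounded (sD n).
  have -> : \int[mu]_(y in B) (f y * adj (fun x => g x - g_ n x) y) =
      c' - \int[mu]_(y in B) (f y * adj (g_ n) y).
    rewrite -RintegralB//; try exact: sqint_mul.
    apply: ae_eq_Rintegral => //.
    - by apply: measurable_funM; [exact: sf.1|exact: sAD.1].
    - by apply: measurable_funB; apply: measurable_funM; rewrite ?sf.1 ?sAg.1 ?sAg_.1//;
        [exact: sf.1|exact: sAg.1|exact: sf.1|exact: sAg_.1].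
    - by apply: filterS (adjB sg (sg_ n)) => y h By; rewrite h// mulrBr.
  by rewrite g_pair; ring.
pose a := \int[mu]_(x in B) (Kf x ^+ 2) + \int[mu]_(x in B) (f x ^+ 2).
have a0 : 0 <= a by apply: addr_ge0; apply: Rintegral_ge0 => x _; exact: sqr_ge0.
have bound e : 0 < e -> `|c - c'| <= e * (a + (1 + C)).
  move=> e0; have [n Vn] := cD (e ^+ 2) (exprn_gt0 _ e0).
  have [sAD bAD] := adj_bounded (sD n).
  rewrite (cE n) (le_trans (ler_normB _ _))//.
  have H1 := le_Rintegral_mul mB e0 sKf (sD n).
  have H2 := le_Rintegral_mul mB e0 sf sAD.
  apply: (le_trans (lerD H1 H2)); rewrite /a.
  have e1 : 0 <= e^-1 by rewrite invr_ge0 ltW.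
  have H3 := ler_wpM2l e1 Vn.
  have H4 := ler_wpM2l e1 (le_trans bAD (ler_wpM2l C0 Vn)).
  have ee : e^-1 * e ^+ 2 = e by rewrite expr2 mulKf// gt_eqF.
  rewrite ee in H3; rewrite mulrCA ee in H4.
  apply: (le_trans (lerD (lerD (lexx _) H3) (lerD (lexx _) H4))).
  by rewrite le_eqVlt; apply/orP; left; apply/eqP; ring.
apply/eqP; rewrite -subr_eq0 -normr_eq0; apply/eqP/le_anti; rewrite normr_ge0 andbT.
apply/ler_addgt0Pr => e e0; rewrite add0r.
have b0 : 0 < a + (1 + C) by rewrite ltr_wpDl// ltr_pwDl.
have := bound (e / (a + (1 + C))) (divr_gt0 e0 b0).
by rewrite divfK ?gt_eqF.
Qed.

End operator_pairing.

(** * Complex conjugation and the Green function *)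

Lemma limN_total {T : Type} {R : realType} (F : set_system T) {FF : ProperFilter F}
  (f : T -> R) : lim ((fun x => - f x) @ F) = - lim (f @ F).
Proof.
have [fcv|fdv] := pselect (cvg (f @ F)); first exact: limN.
have dvg0 (g : T -> R) : ~ cvg (g @ F) -> lim (g @ F) = 0.
  by move=> gdv; rewrite /lim; apply: xgetPN => l gl; apply: gdv; apply/cvg_ex; exists l.
rewrite (dvg0 _ fdv) oppr0; apply: dvg0 => Nfcv; apply: fdv.
suff -> : f = (fun x => - - f x) by exact: is_cvgN Nfcv.
by apply/funext => x; rewrite opprK.
Qed.

Section complex_parts.
Context {R : realType}.
Implicit Types z w : R[i].

Lemma ReM z w : complex.Re (z * w) =
  complex.Re z * complex.Re w - complex.Im z * complex.Im w.
Proof. by case: z w => [a b] [c e]. Qed.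

Lemma ImM z w : complex.Im (z * w) =
  complex.Re z * complex.Im w + complex.Im z * complex.Re w.
Proof. by case: z w => [a b] [c e]. Qed.

Lemma ReB z w : complex.Re (z - w) = complex.Re z - complex.Re w.
Proof. by case: z w => [a b] [c e]. Qed.

Lemma ImB z w : complex.Im (z - w) = complex.Im z - complex.Im w.
Proof. by case: z w => [a b] [c e]. Qed.

Lemma ReD z w : complex.Re (z + w) = complex.Re z + complex.Re w.
Proof. by case: z w => [a b] [c e]. Qed.

Lemma ImD z w : complex.Im (z + w) = complex.Im z + complex.Im w.
Proof. by case: z w => [a b] [c e]. Qed.

Lemma Re_conj z : complex.Re z^* = complex.Re z.
Proof. by case: z. Qed.

Lemma Im_conj z : complex.Im z^* = - complex.Im z.
Proof. by case: z. Qed.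

Lemma Re_sum (I : Type) (r : seq I) (F : I -> R[i]) :
  complex.Re (\sum_(i <- r) F i) = \sum_(i <- r) complex.Re (F i).
Proof. by elim/big_rec2: _ => // i x y _ <-; rewrite ReD. Qed.

Lemma Im_sum (I : Type) (r : seq I) (F : I -> R[i]) :
  complex.Im (\sum_(i <- r) F i) = \sum_(i <- r) complex.Im (F i).
Proof. by elim/big_rec2: _ => // i x y _ <-; rewrite ImD. Qed.

Lemma complex_eq z w : complex.Re z = complex.Re w -> complex.Im z = complex.Im w -> z = w.
Proof. by case: z w => [a b] [c e] /= -> ->. Qed.

Lemma real_complexV (c : R) : (c%:C)^-1 = (c^-1)%:C :> R[i].
Proof. exact/esym/(fmorphV (real_complex R)). Qed.

Lemma conjc_conjc z : (z^*)^* = z.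
Proof. exact: conjcK. Qed.

Lemma conjcB z w : (z - w)^* = z^* - w^*.
Proof. exact: (raddfB (@conjc R)). Qed.

Lemma conjcN z : (- z)^* = - z^*.
Proof. exact: (raddfN (@conjc R)). Qed.

Lemma conjcM z w : (z * w)^* = z^* * w^*.
Proof. exact: (rmorphM (@conjc R)). Qed.

Lemma conjcMr (c : R) z : (c%:C * z)^* = c%:C * z^*.
Proof. by rewrite conjcM; congr (_ * _); exact: conjc_real. Qed.

Lemma conjc_sum (I : Type) (r : seq I) (F : I -> R[i]) :
  (\sum_(i <- r) F i)^* = \sum_(i <- r) (F i)^*.
Proof. exact: (raddf_sum (@conjc R)). Qed.

Lemma expi_neq0 (x : R) : expi x != 0.
Proof.
apply/eqP => -[cx sx]; have := cos2Dsin2 x.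
by rewrite cx sx expr0n/= addr0 => /esym/eqP; rewrite oner_eq0.
Qed.

Lemma climn_conj (u : nat -> R[i]) : climn (fun n => (u n)^*) = (climn u)^*.
Proof.
rewrite /climn /=; congr (_ +i* _).
  by congr (limn _); apply/funext => n; rewrite Re_conj.
by rewrite -limN_total; congr (limn _); apply/funext => n; rewrite Im_conj.
Qed.

Lemma conj_fsum (I : choiceType) (A : set I) (F : I -> R[i]) :
  (\sum_(i \in A) F i)^* = \sum_(i \in A) (F i)^*.
Proof.
rewrite (raddf_sum (@conjc R)) /finite_support !unlock.
rewrite (_ : (fun i => (F i)^*) @^-1` _ = (F @^-1` [set~ 0]))//.
by apply/seteqP; split=> i /= /eqP Fi; apply/eqP; rewrite ?conjc_eq0// -conjc_eq0.
Qed.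

End complex_parts.

Lemma expi_div_conj {R : realType} (t c : R) : (expi t / c%:C)^* = expi (- t) / c%:C.
Proof.
rewrite real_complexV; apply: complex_eq;
  rewrite ?Re_conj ?Im_conj ?ReM ?ImM /= cosN sinN; ring.
Qed.

Section green_function.
Context {R : realType} {d : nat}.
Variables (L Y : set 'rV[R]_d).
Implicit Types (alpha q x y : 'rV[R]_d).

Lemma dotNl x y : dot (- x) y = - dot x y.
Proof. by rewrite /dot -sumrN; apply: eq_bigr => k _; rewrite mxE mulNr. Qed.

Lemma dotNr x y : dot x (- y) = - dot x y.
Proof. by rewrite /dot -sumrN; apply: eq_bigr => k _; rewrite mxE mulrN. Qed.

Lemma enormN x : enorm (- x) = enorm x.
Proof. by rewrite /enorm dotNl dotNr opprK. Qed.

Lemma dual_latticeN q : dual_lattice L q -> dual_lattice L (- q).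
Proof.
move=> Lq l /Lq[k qk]; exists (- k).
by rewrite dotNl qk intrN mulrN.
Qed.

Local Notation freqs alpha n := [set q | dual_lattice L q /\ enorm (alpha + q) <= n%:R].

Local Notation wave alpha x y q :=
  (expi (dot (alpha + q) (x - y)) / (enorm (alpha + q) ^+ 2)%:C).

Lemma waveE alpha x y q : wave alpha x y q =
  (cos (dot (alpha + q) (x - y)) / enorm (alpha + q) ^+ 2) +i*
  (sin (dot (alpha + q) (x - y)) / enorm (alpha + q) ^+ 2).
Proof.
rewrite real_complexV; apply: complex_eq; rewrite /= ?mulr0 ?subr0 ?add0r//.
Qed.

Lemma green_conj alpha x y : (green L Y alpha x y)^* =
  - ((fine (volume Y))^-1)%:C * climn (fun n => \sum_(q \in freqs alpha n)
     (wave alpha x y q)^*).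
Proof.
have conjNM (c : R) z : (- c%:C * z)^* = - c%:C * z^*.
  by rewrite rmorphM rmorphN; congr (- _ * _); exact: conjc_real.
rewrite /green conjNM -climn_conj.
by congr (_ * climn _); apply/funext => n; rewrite conj_fsum.
Qed.

Lemma green_swap alpha x y : green L Y alpha y x = (green L Y alpha x y)^*.
Proof.
rewrite green_conj /green; congr (_ * climn _); apply/funext => n.
by apply: eq_fsbigr => q _; rewrite expi_div_conj -dotNr opprB.
Qed.

Lemma green_opp alpha x y : green L Y (- alpha) x y = (green L Y alpha x y)^*.
Proof.
rewrite green_conj /green; congr (_ * climn _); apply/funext => n.
rewrite (reindex_fsbig (-%R) (freqs alpha n)); last first.
  split.
  - move=> q [Lq qn]; split; first exact: dual_latticeN.
    by rewrite -opprD enormN.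
  - by move=> p q _ _ /oppr_inj.
  - move=> q [Lq qn]; exists (- q); last exact: opprK.
    split; first exact: dual_latticeN.
    by rewrite -[alpha]opprK -opprD enormN.
by apply: eq_fsbigr => q _; rewrite expi_div_conj -opprD dotNl enormN.
Qed.

Lemma freq_support alpha n : exists s : seq 'rV[R]_d, forall x y,
  \sum_(q \in freqs alpha n) wave alpha x y q = \sum_(q <- s) wave alpha x y q.
Proof.
exists (finite_support 0 (freqs alpha n) (fun q => enorm (alpha + q))) => x y.
rewrite /finite_support !unlock.
rewrite (_ : (fun q => wave alpha x y q) @^-1` _ =
    (fun q => enorm (alpha + q)) @^-1` [set~ 0])//.
have waveP q : (wave alpha x y q == 0) = (enorm (alpha + q) == 0).
  rewrite mulf_eq0 (negbTE (expi_neq0 _)) invr_eq0 /=.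
  by rewrite (inj_eq (@complexI R) _ 0) sqrf_eq0.
by apply/seteqP; split=> q /= /eqP qP; apply/eqP; rewrite ?waveP// -waveP.
Qed.

End green_function.

Section green_measurable.
Context {R : realType} {d : nat}.
Variables (L Y : set 'rV[R]_d) (alpha : 'rV[R]_d).
Local Notation T := (surface_space R d).

Lemma measurable_dot_diff (v : 'rV[R]_d) :
  measurable_fun setT (fun z : T * T => dot v (z.1 - z.2)).
Proof.
rewrite /dot; apply: measurable_sum => k.
apply: measurable_funM; first exact: measurable_cst.
rewrite (_ : (fun z : T * T => _) =
    (fun z : T * T => (z.1 : 'rV[R]_d) 0 k - (z.2 : 'rV[R]_d) 0 k)).
  apply: measurable_funB.
    exact: (measurableT_comp (measurable_coord k) measurable_fst).
  exact: (measurableT_comp (measurable_coord k) measurable_snd).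
by apply/funext => z; rewrite !mxE.
Qed.

Lemma measurable_green_Re :
  measurable_fun setT (fun z : T * T => complex.Re (green L Y alpha z.1 z.2)).
Proof.
rewrite /green; under eq_fun do rewrite ReM /= oppr0 mul0r subr0.
apply: measurable_funM; first exact: measurable_cst.
apply: measurable_fun_limn => n; have [s sE] := freq_support L alpha n.
under eq_fun do rewrite sE Re_sum.
apply: measurable_sum => q; under eq_fun do rewrite waveE.
apply: measurable_funM; last exact: measurable_cst.
apply: (measurableT_comp (f := cos)); last exact: measurable_dot_diff.
apply: continuous_measurable_fun => x; exact: continuous_cos.
Qed.

Lemma measurable_green_Im :
  measurable_fun setT (fun z : T * T => complex.Im (green L Y alpha z.1 z.2)).
Proof.
rewrite /green; under eq_fun do rewrite ImM /= oppr0 mul0r addr0.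
apply: measurable_funM; first exact: measurable_cst.
apply: measurable_fun_limn => n; have [s sE] := freq_support L alpha n.
under eq_fun do rewrite sE Im_sum.
apply: measurable_sum => q; under eq_fun do rewrite waveE.
apply: measurable_funM; last exact: measurable_cst.
apply: (measurableT_comp (f := sin)); last exact: measurable_dot_diff.
apply: continuous_measurable_fun => x; exact: continuous_sin.
Qed.

End green_measurable.

Section complex_square_integrable.
Context d (T : measurableType d) (R : realType) (mu : {measure set T -> \bar R}).
Variables (B : set T) (mB : measurable B).
Implicit Types (f : T -> R[i]) (p q : T -> R).

Lemma integral_csqnorm f : cmeasurable_fun B f ->
  (\int[mu]_(x in B) (csqnorm (f x))%:E =
   \int[mu]_(x in B) (complex.Re (f x) ^+ 2)%:E +
   \int[mu]_(x in B) (complex.Im (f x) ^+ 2)%:E)%E.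
Proof.
move=> [mRe mIm]; rewrite -ge0_integralD//.
- by move=> x _; rewrite lee_fin sqr_ge0.
- by apply/measurable_EFinP; exact: measurable_funX.
- by move=> x _; rewrite lee_fin sqr_ge0.
- by apply/measurable_EFinP; exact: measurable_funX.
Qed.

Lemma sqint_lty p : measurable_fun B p ->
  (\int[mu]_(x in B) (p x ^+ 2)%:E < +oo)%E -> sqint mu B p.
Proof.
move=> mp ip; split=> //; apply/integrableP; split.
  by apply/measurable_EFinP; exact: measurable_funX.
rewrite (_ : (fun x => _) = (fun x => (p x ^+ 2)%:E))//.
by apply/funext => x; rewrite gee0_abs// lee_fin sqr_ge0.
Qed.

Lemma sqint_Rintegral p : sqint mu B p ->
  (\int[mu]_(x in B) (p x ^+ 2)%:E = (\int[mu]_(x in B) (p x ^+ 2))%:E)%E.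
Proof. by move=> [_ ip]; rewrite fineK//; exact: integrable_fin_num ip. Qed.

Lemma csqnorm_ltyP f : cmeasurable_fun B f ->
  ((\int[mu]_(x in B) (csqnorm (f x))%:E < +oo)%E <->
  sqint mu B (fun x => complex.Re (f x)) /\ sqint mu B (fun x => complex.Im (f x))).
Proof.
have int0 p : (0 <= \int[mu]_(x in B) (p x ^+ 2)%:E)%E.
  by apply: integral_ge0 => x _; rewrite lee_fin sqr_ge0.
move=> mf; rewrite integral_csqnorm//; split=> [fy|[sRe sIm]].
  case: mf => mRe mIm.
  by split; apply: sqint_lty => //; apply: le_lt_trans fy; [rewrite leeDl|rewrite leeDr].
by rewrite !sqint_Rintegral// -EFinD ltry.
Qed.

Lemma sqint0 : sqint mu B (cst 0).
Proof.
split; first exact: measurable_cst.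
rewrite (_ : (fun x => _) = cst 0%E); first exact: integrable0.
by apply/funext => x; rewrite expr0n.
Qed.

End complex_square_integrable.

Section hermitian_kernel.
Context d (T : measurableType d) (R : realType) (mu : {measure set T -> \bar R}).
Variables (B : set T) (mB : measurable B) (G : T -> T -> R[i]).
Implicit Types (p q w c : T -> R).

Definition kernel_Re p x := \int[mu]_(y in B) (complex.Re (G x y) * p y).

Definition kernel_Im p x := \int[mu]_(y in B) (complex.Im (G x y) * p y).

Local Notation Sr := kernel_Re.
Local Notation Si := kernel_Im.
Local Notation I p q := (\int[mu]_(x in B) (p x * q x)).

Hypotheses (mGRe : measurable_fun setT (fun z : T * T => complex.Re (G z.1 z.2)))
  (mGIm : measurable_fun setT (fun z : T * T => complex.Im (G z.1 z.2)))
  (G_herm : forall x y, G y x = (G x y)^*).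

Hypothesis kernel_integrable : forall p, sqint mu B p ->
  {ae mu, forall x, B x ->
    mu.-integrable B (fun y => (complex.Re (G x y) * p y)%:E) /\
    mu.-integrable B (fun y => (complex.Im (G x y) * p y)%:E)}.

Variables (C : R).
Hypotheses (C0 : 0 <= C) (kernel_bounded : forall p, sqint mu B p ->
  [/\ sqint mu B (Sr p), sqint mu B (Si p),
      \int[mu]_(x in B) (Sr p x ^+ 2) <= C * \int[mu]_(x in B) (p x ^+ 2) &
      \int[mu]_(x in B) (Si p x ^+ 2) <= C * \int[mu]_(x in B) (p x ^+ 2)]).

Let sSr p : sqint mu B p -> sqint mu B (Sr p).
Proof. by case/kernel_bounded. Qed.

Let sSi p : sqint mu B p -> sqint mu B (Si p).
Proof. by case/kernel_bounded. Qed.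

Let GRe x y : complex.Re (G x y) = complex.Re (G y x).
Proof. by rewrite [in RHS]G_herm Re_conj. Qed.

Let GIm x y : complex.Im (G x y) = - complex.Im (G y x).
Proof. by rewrite [in RHS]G_herm Im_conj opprK. Qed.

Lemma kernel_Re_sym p q : sqint mu B p -> sqint mu B q -> I (Sr p) q = I (Sr q) p.
Proof.
move=> sp sq.
have swapE h y : \int[mu]_(x in B) (complex.Re (G x y) * h x) = Sr h y.
  by apply: eq_Rintegral => x _; rewrite GRe.
have := @operator_pairing _ _ _ mu B mB (fun x y => complex.Re (G x y)) mGRe C C0
  _ _ p q sp sq.
rewrite (_ : \int[mu]_(y in B) (p y * _) = I (Sr q) p); last first.
  by apply: eq_Rintegral => y _; rewrite swapE mulrC.
apply.
- move=> h /kernel_integrable; apply: filterS => y H /H[iRe _].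
  by apply: eq_integrable iRe => // x _; rewrite GRe.
- move=> h /kernel_bounded[sR _ bR _]; split.
    by apply: eq_sqint sR => // y _; rewrite swapE.
  by under eq_Rintegral do rewrite swapE.
- by have := kernel_integrable sp; apply: filterS => y H /H[].
- exact: sSr.
Qed.

Lemma kernel_Im_antisym p q : sqint mu B p -> sqint mu B q -> I (Si p) q = - I (Si q) p.
Proof.
move=> sp sq.
have swapE h y : sqint mu B h ->
    \int[mu]_(x in B) (complex.Im (G x y) * h x) = - Si h y.
  move=> sh; rewrite -mulN1r /Si -Rintegral_mull//.
    by apply: eq_Rintegral => x _; rewrite GIm mulN1r mulNr.
  apply: measurable_funM; last exact: sh.1.
  apply: measurable_funTS.
  exact: (measurableT_comp mGIm (measurable_pair1 y)).
have := @operator_pairing _ _ _ mu B mB (fun x y => complex.Im (G x y)) mGIm C C0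
  _ _ p q sp sq.
rewrite (_ : \int[mu]_(y in B) (p y * _) = - I (Si q) p); last first.
  have mI : measurable_fun B (fun x => Si q x * p x).
    by apply: measurable_funM; [have [] := sSi sq|exact: sp.1].
  rewrite -mulN1r -Rintegral_mull//.
  by apply: eq_Rintegral => y _; rewrite swapE// mulrN mulN1r mulrC.
apply.
- move=> h /kernel_integrable; apply: filterS => y H /H[_ iIm].
  have := integrableN iIm; apply: eq_integrable => // x _ /=.
  by rewrite [in RHS]GIm mulNr EFinN.
- move=> h sh; have [_ sI _ bI] := kernel_bounded sh; split.
    by apply: (eq_sqint mB _ (sqintN mB sI)) => y _; rewrite swapE.
  by under eq_Rintegral do rewrite swapE// sqrrN.
- by have := kernel_integrable sp; apply: filterS => y H /H[].
- exact: sSi.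
Qed.

Section equations.
Variables (f1 f2 g1 g2 c e : T -> R).
Hypotheses (sf1 : sqint mu B f1) (sf2 : sqint mu B f2)
  (sg1 : sqint mu B g1) (sg2 : sqint mu B g2)
  (mc : measurable_fun B c) (me : measurable_fun B e).
Hypotheses
  (fRe : {ae mu, forall x, B x -> Sr f1 x - Si f2 x = c x})
  (fIm : {ae mu, forall x, B x -> Sr f2 x + Si f1 x = 0})
  (gRe : {ae mu, forall x, B x -> Sr g1 x - Si g2 x = e x})
  (gIm : {ae mu, forall x, B x -> Sr g2 x + Si g1 x = 0}).

Let IB p q a w : sqint mu B p -> sqint mu B q -> measurable_fun B a -> sqint mu B w ->
  {ae mu, forall x, B x -> p x - q x = a x} -> I a w = I p w - I q w.
Proof.
move=> sp sq ma sw pqa; rewrite -RintegralB//; try exact: sqint_mul.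
apply: ae_eq_Rintegral => //.
- by apply: measurable_funM => //; exact: sw.1.
- by apply: measurable_funB; apply: measurable_funM;
    [exact: sp.1|exact: sw.1|exact: sq.1|exact: sw.1].
- by apply: filterS pqa => x h Bx; rewrite -(h Bx) mulrBl.
Qed.

Let ID p q w : sqint mu B p -> sqint mu B q -> sqint mu B w ->
  {ae mu, forall x, B x -> p x + q x = 0} -> I p w + I q w = 0.
Proof.
move=> sp sq sw pq0; rewrite -RintegralD//; try exact: sqint_mul.
rewrite (@ae_eq_Rintegral _ _ _ mu B mB _ (cst 0)).
- by rewrite /Rintegral integral0.
- by apply: measurable_funD; apply: measurable_funM;
    [exact: sp.1|exact: sw.1|exact: sq.1|exact: sw.1].
- exact: measurable_cst.
- by apply: filterS pq0 => x h Bx; rewrite -mulrDl h// mul0r.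
Qed.

Lemma hermitian_pairing_Re : I c g1 = I e f1.
Proof.
have := IB (sSr sf1) (sSi sf2) mc sg1 fRe.
have := IB (sSr sg1) (sSi sg2) me sf1 gRe.
have := ID (sSr sf2) (sSi sf1) sg2 fIm.
have := ID (sSr sg2) (sSi sg1) sf2 gIm.
rewrite (kernel_Re_sym sf1 sg1) (kernel_Re_sym sf2 sg2).
rewrite (kernel_Im_antisym sf2 sg1) (kernel_Im_antisym sf1 sg2).
move: (I _ _) (I _ _) (I _ _) (I _ _) (I _ _) (I _ _) => *; lra.
Qed.

Lemma hermitian_pairing_Im : I c g2 = - I e f2.
Proof.
have := IB (sSr sf1) (sSi sf2) mc sg2 fRe.
have := IB (sSr sg1) (sSi sg2) me sf2 gRe.
have := ID (sSr sf2) (sSi sf1) sg1 fIm.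
have := ID (sSr sg2) (sSi sg1) sf1 gIm.
rewrite (kernel_Re_sym sf1 sg2) (kernel_Re_sym sf2 sg1).
rewrite (kernel_Im_antisym sf2 sg2) (kernel_Im_antisym sf1 sg1).
move: (I _ _) (I _ _) (I _ _) (I _ _) (I _ _) (I _ _) => *; lra.
Qed.

End equations.
End hermitian_kernel.

Section integral_operator.
Context d (T : measurableType d) (R : realType) (mu : {measure set T -> \bar R}).
Variables (B : set T) (mB : measurable B).
Implicit Types (f phi psi : T -> R[i]) (p q : T -> R) (A E : set T).

Definition csqint f :=
  cmeasurable_fun B f /\ (\int[mu]_(x in B) (csqnorm (f x))%:E < +oo)%E.

Lemma csqintP f : csqint f <->
  sqint mu B (fun x => complex.Re (f x)) /\ sqint mu B (fun x => complex.Im (f x)).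
Proof.
split=> [[mf fy]|sf]; first exact/(csqnorm_ltyP mu mB mf).
have mf : cmeasurable_fun B f by split; [exact: sf.1.1|exact: sf.2.1].
by split=> //; exact/(csqnorm_ltyP mu mB mf).
Qed.

Lemma csqint_real p : sqint mu B p -> csqint (fun x => (p x)%:C).
Proof. by move=> sp; apply/csqintP; split=> //; exact: sqint0. Qed.

Lemma csqintB f1 f2 : csqint f1 -> csqint f2 -> csqint (fun x => f1 x - f2 x).
Proof.
move=> /csqintP[Re1 Im1] /csqintP[Re2 Im2]; apply/csqintP; split.
  by apply: (eq_sqint mB _ (sqintB mB Re1 Re2)) => x _; rewrite ReB.
by apply: (eq_sqint mB _ (sqintB mB Im1 Im2)) => x _; rewrite ImB.
Qed.

Lemma ae_eq_cintegral A f1 f2 : measurable A -> A `<=` B ->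
  cmeasurable_fun B f1 -> cmeasurable_fun B f2 ->
  {ae mu, forall x, B x -> f1 x = f2 x} -> cintegral mu A f1 = cintegral mu A f2.
Proof.
move=> mA AB [mRe1 mIm1] [mRe2 mIm2] f12.
rewrite /cintegral; congr (_ +i* _); apply: ae_eq_Rintegral => //;
  try exact: measurable_funS AB _; by apply: filterS f12 => x h /AB/h ->.
Qed.

Variable G : T -> T -> R[i].

Definition integral_op phi x := cintegral mu B (fun y => G x y * phi y).

Local Notation S := integral_op.

Lemma integral_op_real p x :
  S (fun y => (p y)%:C) x = kernel_Re mu B G p x +i* kernel_Im mu B G p x.
Proof.
rewrite /S /cintegral; congr (_ +i* _); apply: eq_Rintegral => y _.
  by rewrite ReM /= mulr0 subr0.
by rewrite ImM /= mulr0 add0r.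
Qed.

Hypothesis op_integrable : forall phi, csqint phi ->
  {ae mu, forall x, B x -> cintegrable mu B (fun y => G x y * phi y)}.

Lemma op_inj phi1 phi2 :
  (forall phi, csqint phi -> {ae mu, forall x, B x -> S phi x = 0} ->
    {ae mu, forall x, B x -> phi x = 0}) ->
  csqint phi1 -> csqint phi2 -> {ae mu, forall x, B x -> S phi1 x = S phi2 x} ->
  {ae mu, forall x, B x -> phi1 x = phi2 x}.
Proof.
move=> ker s1 s2 S12.
have : {ae mu, forall x, B x -> phi1 x - phi2 x = 0}.
  apply: (ker _ (csqintB s1 s2)).
  apply: filterS3 (op_integrable s1) (op_integrable s2) S12 => x i1 i2 + Bx.
  have [R1 I1] := i1 Bx; have [R2 I2] := i2 Bx => /(_ Bx)[ReE ImE].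
  rewrite /S /cintegral; apply: complex_eq => /=.
    under eq_Rintegral do rewrite mulrBr ReB.
    by rewrite RintegralB// ReE subrr.
  under eq_Rintegral do rewrite mulrBr ImB.
  by rewrite RintegralB// ImE subrr.
by apply: filterS => x h /h /eqP; rewrite subr_eq0 => /eqP.
Qed.

Hypothesis op_bounded : exists K : R, forall phi, csqint phi -> csqint (S phi) /\
  (\int[mu]_(x in B) (csqnorm (S phi x))%:E <=
   K%:E * \int[mu]_(x in B) (csqnorm (phi x))%:E)%E.

Let kernel_integrable p : sqint mu B p ->
  {ae mu, forall x, B x ->
    mu.-integrable B (fun y => (complex.Re (G x y) * p y)%:E) /\
    mu.-integrable B (fun y => (complex.Im (G x y) * p y)%:E)}.
Proof.
move=> /csqint_real/op_integrable; apply: filterS => x H /H[iRe iIm]; split.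
  by apply: eq_integrable iRe => // y _; rewrite ReM /= mulr0 subr0.
by apply: eq_integrable iIm => // y _; rewrite ImM /= mulr0 add0r.
Qed.

Let kernel_bounded : exists2 C : R, 0 <= C & forall p, sqint mu B p ->
  [/\ sqint mu B (kernel_Re mu B G p), sqint mu B (kernel_Im mu B G p),
      \int[mu]_(x in B) (kernel_Re mu B G p x ^+ 2) <= C * \int[mu]_(x in B) (p x ^+ 2) &
      \int[mu]_(x in B) (kernel_Im mu B G p x ^+ 2) <= C * \int[mu]_(x in B) (p x ^+ 2)].
Proof.
have [K HK] := op_bounded; exists `|K| => // p sp.
have [sS Sp] := HK _ (csqint_real sp).
have [sRe sIm] := (iffLR (csqintP _)) sS.
have {}sRe : sqint mu B (kernel_Re mu B G p).
  by apply: (eq_sqint mB _ sRe) => x _; rewrite integral_op_real.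
have {}sIm : sqint mu B (kernel_Im mu B G p).
  by apply: (eq_sqint mB _ sIm) => x _; rewrite integral_op_real.
have int0 (h : T -> R) : 0 <= \int[mu]_(x in B) (h x ^+ 2).
  by apply: Rintegral_ge0 => x _; exact: sqr_ge0.
have H : \int[mu]_(x in B) (kernel_Re mu B G p x ^+ 2) +
    \int[mu]_(x in B) (kernel_Im mu B G p x ^+ 2) <= K * \int[mu]_(x in B) (p x ^+ 2).
  rewrite -lee_fin EFinD EFinM -!sqint_Rintegral//.
  have -> : (\int[mu]_(x in B) (p x ^+ 2)%:E = \int[mu]_(x in B) (csqnorm (p x)%:C)%:E)%E.
    by apply: eq_integral => x _; rewrite /csqnorm /= expr0n addr0.
  apply: le_trans Sp; rewrite integral_csqnorm//; last exact: sS.1.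
  by rewrite le_eqVlt; apply/orP; left; apply/eqP; congr (_ + _)%E;
    apply: eq_integral => x _; rewrite integral_op_real.
have KK : K * \int[mu]_(x in B) (p x ^+ 2) <= `|K| * \int[mu]_(x in B) (p x ^+ 2).
  by rewrite ler_wpM2r// ler_norm.
split=> //; apply: le_trans (le_trans H KK); first by rewrite lerDl.
by rewrite lerDr.
Qed.

Let op_Re phi : csqint phi -> {ae mu, forall x, B x ->
  complex.Re (S phi x) = kernel_Re mu B G (fun y => complex.Re (phi y)) x -
    kernel_Im mu B G (fun y => complex.Im (phi y)) x}.
Proof.
move=> /csqintP[/kernel_integrable HRe /kernel_integrable HIm].
move: HRe HIm; apply: filterS2 => x + + Bx => /(_ Bx)[iRR _] /(_ Bx)[_ iII].
rewrite /= /kernel_Re /kernel_Im -RintegralB//; apply: eq_Rintegral => y _; exact: ReM.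
Qed.

Let op_Im phi : csqint phi -> {ae mu, forall x, B x ->
  complex.Im (S phi x) = kernel_Re mu B G (fun y => complex.Im (phi y)) x +
    kernel_Im mu B G (fun y => complex.Re (phi y)) x}.
Proof.
move=> /csqintP[/kernel_integrable HRe /kernel_integrable HIm].
move: HRe HIm; apply: filterS2 => x + + Bx => /(_ Bx)[_ iIR] /(_ Bx)[iRI _].
rewrite /= /kernel_Re /kernel_Im -RintegralD//; apply: eq_Rintegral => y _; exact: ImM.
Qed.

Hypotheses (mGRe : measurable_fun setT (fun z : T * T => complex.Re (G z.1 z.2)))
  (mGIm : measurable_fun setT (fun z : T * T => complex.Im (G z.1 z.2)))
  (G_herm : forall x y, G y x = (G x y)^*).

Lemma hermitian_op_indic A E phi psi : measurable A -> measurable E ->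
  A `<=` B -> E `<=` B -> csqint phi -> csqint psi ->
  {ae mu, forall x, B x -> S phi x = (\1_A x)%:C} ->
  {ae mu, forall x, B x -> S psi x = (\1_E x)%:C} ->
  cintegral mu A psi = (cintegral mu E phi)^*.
Proof.
move=> mA mE AB EB sphi spsi SA SE.
have [phiR phiI] := (iffLR (csqintP _)) sphi.
have [psiR psiI] := (iffLR (csqintP _)) spsi.
have ReE f F : csqint f -> {ae mu, forall x, B x -> S f x = (\1_F x)%:C} ->
    {ae mu, forall x, B x -> kernel_Re mu B G (fun y => complex.Re (f y)) x -
    kernel_Im mu B G (fun y => complex.Im (f y)) x = \1_F x}.
  move=> /op_Re; apply: filterS2 => x h + Bx; rewrite -(h Bx).
  by move=> /(_ Bx) ->.
have ImE f F : csqint f -> {ae mu, forall x, B x -> S f x = (\1_F x)%:C} ->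
    {ae mu, forall x, B x -> kernel_Re mu B G (fun y => complex.Im (f y)) x +
    kernel_Im mu B G (fun y => complex.Re (f y)) x = 0}.
  move=> /op_Im; apply: filterS2 => x h + Bx; rewrite -(h Bx).
  by move=> /(_ Bx) ->.
have [C C0 HC] := kernel_bounded.
have indicE F p : F `<=` B -> \int[mu]_(x in B) (\1_F x * p x) = \int[mu]_(x in F) p x.
  move=> FB; rewrite Rintegral_mkcond [RHS]Rintegral_mkcond; apply: eq_Rintegral => x _.
  rewrite !patchE indicE; case: (boolP (x \in F)) => [|xF].
    by rewrite inE mul1r => /FB Bx; rewrite mem_set.
  by rewrite mul0r; case: ifP.
have mI F : measurable F -> measurable_fun B (\1_F : T -> R).
  by move=> mF; exact: measurable_indic.
have HRe := hermitian_pairing_Re mB mGRe mGIm G_herm kernel_integrable C0 HC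
  phiR phiI psiR psiI (mI _ mA) (mI _ mE) (ReE _ _ sphi SA) (ImE _ _ sphi SA)
  (ReE _ _ spsi SE) (ImE _ _ spsi SE).
have HIm := hermitian_pairing_Im mB mGRe mGIm G_herm kernel_integrable C0 HC
  phiR phiI psiR psiI (mI _ mA) (mI _ mE) (ReE _ _ sphi SA) (ImE _ _ sphi SA)
  (ReE _ _ spsi SE) (ImE _ _ spsi SE).
rewrite !indicE// in HRe HIm.
by apply: complex_eq => /=.
Qed.

End integral_operator.

Section conjugation.
Context d (T : measurableType d) (R : realType) (mu : {measure set T -> \bar R}).
Implicit Types (A : set T) (f : T -> R[i]).

Lemma RintegralN A (f : T -> R) : \int[mu]_(x in A) (- f x) = - \int[mu]_(x in A) f x.
Proof.
rewrite /Rintegral integralE [in RHS]integralE.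
rewrite (_ : (fun x => (- f x)%:E) = (\- (fun x => (f x)%:E))%E)// funeposN funenegN.
have := @integral_ge0 _ _ _ mu A _ (fun x _ => funepos_ge0 (fun x => (f x)%:E) x).
have := @integral_ge0 _ _ _ mu A _ (fun x _ => funeneg_ge0 (fun x => (f x)%:E) x).
case: (\int[mu]_(x in A) _)%E => [n| |]//; case: (\int[mu]_(x in A) _)%E => [p| |]// _ _ /=;
  by rewrite ?oppr0// opprB.
Qed.

Lemma cintegral_conj A f : cintegral mu A (fun x => (f x)^*) = (cintegral mu A f)^*.
Proof.
apply: complex_eq; rewrite ?Re_conj ?Im_conj /cintegral /=.
  by apply: eq_Rintegral => x _; rewrite Re_conj.
transitivity (\int[mu]_(x in A) (- complex.Im (f x))); last exact: RintegralN.
by apply: eq_Rintegral => x _; rewrite Im_conj.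
Qed.

Lemma cintegral0 A : cintegral mu A (fun=> 0) = 0.
Proof. by rewrite /cintegral /Rintegral/= integral0. Qed.

Lemma cmeasurable_conj A f : cmeasurable_fun A f -> cmeasurable_fun A (fun x => (f x)^*).
Proof.
move=> [mRe mIm]; split.
  by apply: eq_measurable_fun mRe => x _; rewrite Re_conj.
apply: (eq_measurable_fun (fun x => - complex.Im (f x))) => [x _|].
  by rewrite Im_conj.
exact: measurableT_comp mIm.
Qed.

Lemma cintegrable_conj A f : cintegrable mu A f -> cintegrable mu A (fun x => (f x)^*).
Proof.
move=> [iRe iIm]; split.
  by move: iRe; congr (integrable mu A _); apply/funext => x; rewrite Re_conj.
have := integrableN iIm; congr (integrable mu A _); apply/funext => x.
by rewrite /= Im_conj EFinN.
Qed.

End conjugation.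

Lemma csqnorm_conj {R : realType} (z : R[i]) : csqnorm z^* = csqnorm z.
Proof. by rewrite /csqnorm Re_conj Im_conj sqrrN. Qed.

Section conjugate_function_spaces.
Context {R : realType} {d : nat}.
Local Notation T := (surface_space R d).
Implicit Types (B : set T) (f : T -> R[i]) (u : 'rV[R]_d -> R[i]).

Lemma deriveN_total (v : 'rV[R]_d -> R) x (e : 'rV[R]_d) :
  'D_e (fun y => - v y) x = - 'D_e v x.
Proof.
rewrite /derive -limN_total; apply: (congr1 (fun g : R -> R => lim (g @ 0^'))).
by apply/funext => h /=; rewrite -scalerN opprD.
Qed.

Lemma L2_sqnorm_conj B f : L2_sqnorm B (fun x => (f x)^*) = L2_sqnorm B f.
Proof. by apply: eq_integral => x _; rewrite csqnorm_conj. Qed.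

Lemma L2_conj B f : L2 B f -> L2 B (fun x => (f x)^*).
Proof.
move=> [mf fy]; split; first exact: cmeasurable_conj mf.
by rewrite L2_sqnorm_conj.
Qed.

Lemma C1_onN (U : set 'rV[R]_d) (v : 'rV[R]_d -> R) : C1_on U v -> C1_on U (fun x => - v x).
Proof.
move=> C1v x k Ux; have [dv cv] := C1v x k Ux; split; first exact: derivableN dv.
rewrite (_ : (fun y => _) = (fun y => - 'D_(axis k) v y)); first exact: continuousN cv.
by apply/funext => y; exact: deriveN_total.
Qed.

Lemma C1_near_conj B u : C1_near B u -> C1_near B (fun x => (u x)^*).
Proof.
move=> [U [oU BU C1Re C1Im]]; exists U; split; [exact: oU|exact: BU| |].
  rewrite (_ : (fun x => _) = (fun x => complex.Re (u x))); first exact: C1Re.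
  by apply/funext => x; exact: Re_conj.
rewrite (_ : (fun x => _) = (fun x => - complex.Im (u x))); first exact: C1_onN C1Im.
by apply/funext => x; exact: Im_conj.
Qed.

Lemma partial_conj u k x : partial (fun y => (u y)^*) k x = (partial u k x)^*.
Proof.
apply: complex_eq; rewrite ?Re_conj ?Im_conj /partial /=.
  by congr ('D_ _ _ x); apply/funext => y; exact: Re_conj.
transitivity ('D_(axis k) (fun y => - complex.Im (u y)) x); last exact: deriveN_total.
by congr ('D_ _ _ x); apply/funext => y; exact: Im_conj.
Qed.

Lemma tgrad_conj B u k x : tgrad B (fun y => (u y)^*) k x = (tgrad B u k x)^*.
Proof.
rewrite /tgrad partial_conj conjcB conjcMr conjc_sum.
by congr (_ - _ * _); apply: eq_bigr => l _; rewrite partial_conj conjcMr.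
Qed.

Lemma H1_tgrad_conj B f g : H1_tgrad B f g ->
  H1_tgrad B (fun x => (f x)^*) (fun k x => (g k x)^*).
Proof.
move=> [Lf Lg [u [C1u uf ug]]]; split; first exact: L2_conj.
  by move=> k; exact: L2_conj.
exists (fun n x => (u n x)^*); split.
- by move=> n; exact: C1_near_conj.
- rewrite (_ : (fun n => _) = (fun n => L2_sqnorm B (fun x => u n x - f x))).
    exact: uf.
  apply/funext => n; rewrite -[RHS]L2_sqnorm_conj; congr (L2_sqnorm B _).
  by apply/funext => x; rewrite conjcB.
- move=> k.
  rewrite (_ : (fun n => _) = (fun n => L2_sqnorm B (fun x => tgrad B (u n) k x - g k x))).
    exact: ug.
  apply/funext => n; rewrite -[RHS]L2_sqnorm_conj; congr (L2_sqnorm B _).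
  by apply/funext => x; rewrite tgrad_conj conjcB.
Qed.

Lemma H1_sqnorm_conj B f g : H1_sqnorm B (fun x => (f x)^*) (fun k x => (g k x)^*) =
  H1_sqnorm B f g.
Proof.
rewrite /H1_sqnorm L2_sqnorm_conj; congr (_ + _)%E; apply: eq_bigr => k _.
exact: L2_sqnorm_conj.
Qed.

Lemma H1_conj B f : H1 B f -> H1 B (fun x => (f x)^*).
Proof. by move=> [g fg]; exists (fun k x => (g k x)^*); exact: H1_tgrad_conj. Qed.

End conjugate_function_spaces.

(** * Symmetries of the capacitance matrix *)

Section capacitance_symmetry.
Context {R : realType} {d N : nat}.
Variables (L Y : set 'rV[R]_d) (D : 'I_N -> set 'rV[R]_d).
Local Notation T := (surface_space R d).
Local Notation sigma := (surface_measure R d).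
Local Notation B := (bdD D).
Local Notation S := (single_layer L Y D).
Local Notation psi a j := (single_layer_inv L Y D a (bd_indic D j)).
Implicit Types (a : 'rV[R]_d) (f phi : T -> R[i]).

Lemma measurable_boundary (A : set 'rV[R]_d) : measurable (boundary A : set T).
Proof.
apply: closed_surface_measurable; apply: closedI; first exact: closed_closure.
by apply: open_closedC; exact: open_interior.
Qed.

Lemma single_layer_opp a phi :
  S (- a) phi = (fun x => (S a (fun y => (phi y)^*) x)^*).
Proof.
apply/funext => x; rewrite /single_layer -cintegral_conj.
by congr (cintegral _ _ _); apply/funext => y; rewrite conjcM conjc_conjc green_opp.
Qed.

Lemma ae_eq_on_conj f1 f2 : ae_eq_on B f1 f2 ->
  ae_eq_on B (fun x => (f1 x)^*) (fun x => (f2 x)^*).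
Proof. by apply: filterS => x h Bx; rewrite h. Qed.

Let conjK f : (fun x => ((f x)^*)^*) = f.
Proof. by apply/funext => x; exact: conjc_conjc. Qed.

Let conj0 : (fun x : T => (0 : R[i])^*) = (fun=> 0).
Proof. by apply/funext => x; apply: complex_eq; rewrite ?Re_conj ?Im_conj ?oppr0. Qed.

Lemma single_layer_invertible_opp a :
  single_layer_invertible L Y D a -> single_layer_invertible L Y D (- a).
Proof.
move=> [Sint [K SK] Sinj Ssurj]; split.
- move=> phi Lphi; have := Sint _ (L2_conj Lphi); apply: filterS => x h Bx.
  have := cintegrable_conj (h Bx); congr (cintegrable _ _ _); apply/funext => y.
  by rewrite conjcM conjc_conjc green_opp.
- exists K => phi Lphi; have [g Sg bg] := SK _ (L2_conj Lphi).
  exists (fun k x => (g k x)^*); rewrite single_layer_opp; first exact: H1_tgrad_conj.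
  rewrite H1_sqnorm_conj; apply: (le_trans bg).
  by rewrite L2_sqnorm_conj.
- move=> phi Lphi; rewrite single_layer_opp => /ae_eq_on_conj.
  rewrite conjK conj0 => /(Sinj _ (L2_conj Lphi))/ae_eq_on_conj.
  by rewrite conjK conj0.
- move=> f /H1_conj/Ssurj[phi Lphi Sphi]; exists (fun x => (phi x)^*).
    exact: L2_conj.
  by rewrite single_layer_opp conjK; have := ae_eq_on_conj Sphi; rewrite conjK.
Qed.

Lemma single_layer_unique a phi1 phi2 : single_layer_invertible L Y D a ->
  L2 B phi1 -> L2 B phi2 -> ae_eq_on B (S a phi1) (S a phi2) -> ae_eq_on B phi1 phi2.
Proof.
move=> [Sint _ Sinj _].
exact: (op_inj (measurable_boundary _) Sint Sinj).
Qed.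

Definition bd_solution a j phi := L2 B phi /\ ae_eq_on B (S a phi) (bd_indic D j).

Lemma bd_solution_opp a j phi : bd_solution a j phi ->
  bd_solution (- a) j (fun x => (phi x)^*).
Proof.
move=> [Lphi Sphi]; split; first exact: L2_conj.
rewrite single_layer_opp conjK; have := ae_eq_on_conj Sphi.
congr (ae_eq_on _ _ _); apply/funext => x; exact: conjc_real.
Qed.

Lemma single_layer_inv_cases a j :
  [/\ single_layer_invertible L Y D a & bd_solution a j (psi a j)] \/
  (psi a j = (fun=> 0) /\
   forall phi, ~ (single_layer_invertible L Y D a /\ bd_solution a j phi)).
Proof.
rewrite /single_layer_inv; case: asboolP => [Sa|Sa]; last first.
  by right; split=> // phi [].
have [[phi sphi]|nsphi] := pselect (exists phi, bd_solution a j phi).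
  left; split; [exact: Sa|exact: (@xgetI _ _ [set phi | bd_solution a j phi] phi sphi)].
right; split=> [|phi [_ sphi]]; last by apply: nsphi; exists phi; exact: sphi.
apply: xgetPN => phi sphi; apply: nsphi; exists phi; exact: sphi.
Qed.

Hypothesis D_disjoint : forall i j, i != j -> closure (D i) `&` closure (D j) = set0.

Lemma boundary_sub_bdD i : boundary (D i) `<=` B.
Proof.
move=> x [clx nix]; split.
  by apply: closure_subset clx => y Dy; exists i.
move=> intx; apply: nix.
have far : nbhs x (fun y => forall k, k != i -> ~ closure (D k) y).
  have H (k : 'I_N) : nbhs x (fun y => k != i -> ~ closure (D k) y).
    have [->|ki] := eqVneq k i.
      by apply: (@filterS _ (nbhs x) _ setT) => [y _|]; [move=> /eqP|exact: filterT].
    have nkx : (~` closure (D k)) x.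
      by move=> kx; have := D_disjoint ki; apply/eqP/set0P; exists x; split.
    have oD : open (~` closure (D k)) by apply: closed_openC; exact: closed_closure.
    by have := open_nbhs_nbhs (conj oD nkx); apply: filterS => y + _.
  exact: filter_forall H.
rewrite /interior /= in intx *; apply: filterS2 far intx => y yfar [k _ Dky].
have [<-//|ki] := eqVneq k i.
by exfalso; apply: (yfar _ ki); exact: subset_closure.
Qed.

Local Notation C a := (capacitance L Y D a).

Lemma capacitanceE a i j :
  C a i j = - cintegral sigma (boundary (D i)) (psi a j).
Proof. by rewrite mxE. Qed.

Lemma cintegral_density_opp a i j :
  cintegral sigma (boundary (D i)) (psi (- a) j) =
  (cintegral sigma (boundary (D i)) (psi a j))^*.
Proof.
rewrite -cintegral_conj.
have [[Sa sa]|[-> na]] := single_layer_inv_cases a j.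
  have SNa := single_layer_invertible_opp Sa; have sNa := bd_solution_opp sa.
  have [[_ s]|[_ nNa]] := single_layer_inv_cases (- a) j; last first.
    by exfalso; apply: (nNa _ (conj SNa sNa)).
  apply: (ae_eq_cintegral (measurable_boundary _) (measurable_boundary _)
    (@boundary_sub_bdD i)).
  - exact: s.1.1.
  - exact: sNa.1.1.
  - apply: (single_layer_unique SNa s.1 sNa.1).
    move: s.2 sNa.2; apply: filterS2 => x h1 h2 Bx.
    exact: (eq_trans (h1 Bx) (esym (h2 Bx))).
have [[SNa s]|[-> _]] := single_layer_inv_cases (- a) j; last by rewrite conj0.
have SA := single_layer_invertible_opp SNa; have sA := bd_solution_opp s.
by rewrite opprK in SA sA; case: (na _ (conj SA sA)).
Qed.

Lemma capacitance_opp a i j : C (- a) i j = (C a i j)^*.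
Proof.
apply: (eq_trans (capacitanceE (- a) i j)).
apply: (eq_trans (congr1 -%R (cintegral_density_opp a i j))); apply: esym.
apply: (eq_trans (congr1 (fun z : R[i] => z^*) (capacitanceE a i j))).
exact: conjcN.
Qed.

Lemma capacitance_hermitian a i j :
  (forall k, C a k i = 0) \/ (forall k, C a k j = 0) \/ C a i j = (C a j i)^*.
Proof.
have zero l : psi a l = (fun=> 0) -> forall k, C a k l = 0.
  by move=> p0 k; rewrite capacitanceE p0 cintegral0 oppr0.
have [[Sa si]|[/zero zi _]] := single_layer_inv_cases a i; last by left.
have [[_ sj]|[/zero zj _]] := single_layer_inv_cases a j; last by right; left.
right; right; apply: (eq_trans (capacitanceE a i j)); apply: esym.
apply: (eq_trans (congr1 (fun z : R[i] => z^*) (capacitanceE a j i))).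
apply: (eq_trans (conjcN _)); congr (- _); apply: esym.
case: Sa => Sint [K SK] _ _.
have bounded : exists K : R, forall phi, L2 B phi -> L2 B (S a phi) /\
    (L2_sqnorm B (S a phi) <= K%:E * L2_sqnorm B phi)%E.
  exists K => phi Lphi; have [g [LS Lg _] bg] := SK _ Lphi; split; first exact: LS.
  apply: le_trans bg; rewrite /H1_sqnorm; apply: leeDl; apply: sume_ge0 => k _.
  by apply: integral_ge0 => x _; rewrite lee_fin addr_ge0 ?sqr_ge0.
have swap x y : green L Y a y x = (green L Y a x y)^* by exact: green_swap.
have := hermitian_op_indic (measurable_boundary _) Sint bounded
  (measurable_green_Re L Y a) (measurable_green_Im L Y a) swap
  (measurable_boundary (D i)) (measurable_boundary (D j))
  (@boundary_sub_bdD i) (@boundary_sub_bdD j) si.1 sj.1 si.2 sj.2.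
exact.
Qed.

End capacitance_symmetry.

(** * Rescaled systems of differential equations *)

Section complex_derivative.
Context {R : realType}.
Implicit Types (f : R -> R[i]) (c : R[i]).

Lemma is_derive_lincomb (a b : R) (f g : R -> R) (t df dg : R) :
  is_derive t 1 f df -> is_derive t 1 g dg ->
  is_derive t 1 (fun s => a * f s + b * g s) (a * df + b * dg).
Proof.
move=> hf hg.
have H : is_derive (t : R^o) 1 (fun s : R^o => a *: (f s : R^o) + b *: (g s : R^o))
    (a *: df + b *: dg) by exact: is_deriveD (is_deriveZ _ _) (is_deriveZ _ _).
exact: H.
Qed.

Let is_derive_ReM c f t : cderivable f t ->
  is_derive t 1 (fun s => complex.Re (c * f s)) (complex.Re (c * cderive f t)).
Proof.
move=> [/derivableP dRe /derivableP dIm].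
rewrite (_ : (fun s => _) = (fun s => complex.Re c * complex.Re (f s) +
    - complex.Im c * complex.Im (f s))); last first.
  by apply/funext => s; rewrite ReM mulNr.
by rewrite ReM -mulNr /cderive /= !derive1E; exact: is_derive_lincomb.
Qed.

Let is_derive_ImM c f t : cderivable f t ->
  is_derive t 1 (fun s => complex.Im (c * f s)) (complex.Im (c * cderive f t)).
Proof.
move=> [/derivableP dRe /derivableP dIm].
rewrite (_ : (fun s => _) = (fun s => complex.Re c * complex.Im (f s) +
    complex.Im c * complex.Re (f s))); last first.
  by apply/funext => s; rewrite ImM.
by rewrite ImM /cderive /= !derive1E; exact: is_derive_lincomb.
Qed.

Lemma cderivableM c f t : cderivable f t -> cderivable (fun s => c * f s) t.
Proof.
move=> df; split; first exact: (@ex_derive _ _ _ _ _ _ _ (is_derive_ReM c df)).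
exact: (@ex_derive _ _ _ _ _ _ _ (is_derive_ImM c df)).
Qed.

Lemma cderiveM c f t : cderivable f t ->
  cderive (fun s => c * f s) t = c * cderive f t.
Proof.
move=> df; apply: complex_eq; rewrite [LHS]derive1E.
  exact: (@derive_val _ _ _ _ _ _ _ (is_derive_ReM c df)).
exact: (@derive_val _ _ _ _ _ _ _ (is_derive_ImM c df)).
Qed.

End complex_derivative.

Section rescaling.
Context {R : realType} {N : nat}.
Variables (M M' : R -> 'M[R[i]]_N) (u : 'I_N -> R[i]).
Hypotheses (u_neq0 : forall i, u i != 0)
  (MM' : forall t i j, u i * M t i j = M' t i j * u j).

Definition rescale (phi : R -> 'cV[R[i]]_N) t : 'cV[R[i]]_N := \col_i (u i * phi t i 0).

Lemma rescale_solution phi : is_solution M phi -> is_solution M' (rescale phi).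
Proof.
move=> [dphi ode]; split.
  move=> i t; have [d1 d2] := dphi i t.
  have E : (fun s => rescale phi s i 0) = (fun s => u i * phi s i 0).
    by apply/funext => s; rewrite mxE.
  rewrite E; split; first exact: cderivableM.
  rewrite (_ : cderive _ = (fun s => u i * cderive (fun r => phi r i 0) s)).
    exact: cderivableM.
  by apply/funext => s; exact: (cderiveM _ (dphi i s).1).
move=> t; apply/matrixP => i k; rewrite !ord1 !mxE.
have := congr1 (fun A : 'cV_N => u i * A i 0) (ode t); rewrite !mxE mulr0; apply: etrans.
rewrite mulrDr; congr (_ + _).
  rewrite -cderiveM; last exact: (dphi i t).2.
  congr (cderive _ t); apply/funext => s; rewrite -cderiveM; last exact: (dphi i s).1.
  by congr (cderive _ s); apply/funext => r; rewrite mxE.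
by rewrite mulr_sumr; apply: eq_bigr => j _; rewrite mxE !mulrA MM'.
Qed.

Lemma rescale_quasifrequencies (T : R) :
  quasifrequencies T M `<=` quasifrequencies T M'.
Proof.
move=> w [phi [sol [t phit] per]]; exists (rescale phi); split.
- exact: rescale_solution.
- exists t; apply: contra phit => /eqP r0; apply/eqP/matrixP => i k.
  have := congr1 (fun A : 'cV_N => A i 0) r0; rewrite !mxE ord1 => /eqP.
  by rewrite mulf_eq0 (negbTE (u_neq0 i)) => /eqP.
- move=> s; apply/matrixP => i k; rewrite !mxE per mxE.
  by rewrite mulrCA.
Qed.

End rescaling.

Lemma conjugate_quasifrequencies {R : realType} {N : nat} (M M' : R -> 'M[R[i]]_N)
  (u : 'I_N -> R[i]) (T : R) : (forall i, u i != 0) ->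
  (forall t i j, u i * M t i j = M' t i j * u j) ->
  quasifrequencies T M = quasifrequencies T M'.
Proof.
move=> u0 MM'; apply/seteqP; split; first exact: (rescale_quasifrequencies u0).
apply: (@rescale_quasifrequencies _ _ _ _ (fun i => (u i)^-1)) => [i|t i j].
  by rewrite invr_eq0.
by apply: (mulfI (u0 i)); rewrite mulVKf// mulrA MM' mulfK.
Qed.

Lemma modulated_matrix_rescale {R : realType} {N : nat} (vol : 'I_N -> R)
  (delta kappa_r rho_r : R) (rho kappa : 'I_N -> R -> R) (C C' : 'M[R[i]]_N)
  (u : 'I_N -> R[i]) : (forall i j, u i * C i j = C' i j * u j) ->
  forall t i j,
    u i * modulated_matrix vol delta kappa_r rho_r rho kappa C t i j =
    modulated_matrix vol delta kappa_r rho_r rho kappa C' t i j * u j.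
Proof.
move=> CC' t i j; rewrite /modulated_matrix 2!mul_diag_mx 2!mul_mx_diag !mxE.
have aux (k w1 w2 w3 : R[i]) : u i * (k * (w1 * C i j * w2) + w3 *+ (i == j)) =
    (k * (w1 * C' i j * w2) + w3 *+ (i == j)) * u j.
  have -> : u i * (k * (w1 * C i j * w2) + w3 *+ (i == j)) =
    k * w1 * w2 * (u i * C i j) + u i * w3 *+ (i == j) by rewrite mulrDr mulrnAr; ring.
  rewrite CC' mulrDl; congr (_ + _); first by ring.
  by have [->|_] := eqVneq i j; rewrite ?mulr1n ?mulr0n ?mul0r// mulrC.
exact: aux.
Qed.

(* For two resonators, [u = (z^*, z)] with [z = C 0 1] works because the product
   [C 0 1 * C 1 0] is real. *)
Lemma conj_rescaling_lt3 {R : realType} {N : nat} (C : 'M[R[i]]_N) : (0 < N < 3)%N ->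
  (forall i j, (forall k, C k i = 0) \/ (forall k, C k j = 0) \/ C i j = (C j i)^*) ->
  exists2 u : 'I_N -> R[i], forall i, u i != 0 &
    forall i j, u i * C i j = (C i j)^* * u j.
Proof.
move=> N03 C_herm.
have c0 : (0 : R[i])^* = 0 by apply: complex_eq; rewrite ?Re_conj ?Im_conj ?oppr0.
have diag i : C i i = (C i i)^*.
  by case: (C_herm i i) => [C0|[C0|//]]; rewrite C0 c0.
have offdiag i j : C i j * C j i = (C i j * C j i)^*.
  case: (C_herm i j) => [C0|[C0|->]]; first by rewrite (C0 j) mulr0 c0.
    by rewrite (C0 i) mul0r c0.
  by rewrite conjcM conjc_conjc mulrC.
have conj_eq0 (z : R[i]) : z != 0 -> z^* != 0.
  by apply: contra => /eqP z0; rewrite -[z]conjc_conjc z0 c0.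
case: N C N03 {C_herm} diag offdiag => [//|[|[|//]]] C _ diag offdiag.
  exists (fun=> 1) => [i|i j]; first exact: oner_neq0.
  by rewrite !ord1 mul1r mulr1.
pose i0 : 'I_2 := ord0; pose i1 : 'I_2 := lift ord0 ord0.
pose z := if C i0 i1 != 0 then (C i0 i1)^* else if C i1 i0 != 0 then C i1 i0 else 1.
have z0 : z != 0.
  rewrite /z; case: ifPn => [/conj_eq0//|_]; case: ifPn => // _; exact: oner_neq0.
have E01 : z * C i0 i1 = (C i0 i1)^* * z^*.
  rewrite /z; case: ifPn => [_|]; first by rewrite conjc_conjc.
  by rewrite negbK => /eqP ->; rewrite mulr0 c0 mul0r.
have E10 : z^* * C i1 i0 = (C i1 i0)^* * z.
  rewrite /z; case: ifPn => [_|].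
    by rewrite conjc_conjc offdiag conjcM mulrC.
  move=> _; case: ifPn => [_|]; first by rewrite mulrC.
  by rewrite negbK => /eqP ->; rewrite mulr0 c0 mul0r.
exists (fun i => if i == i0 then z else z^*) => [i|i j].
  by case: ifP => // _; exact: conj_eq0.
have two (k : 'I_2) : k = i0 \/ k = i1.
  by case: k => -[|[|//]] ?; [left|right]; apply: val_inj.
by have [->|->] := two i; have [->|->] := two j; rewrite /= ?E01 ?E10// -diag mulrC.
Qed.

Theorem theorem3p1 (R : realType) (d N : nat) (hd : d = 2%N \/ d = 3%N)
    (L Y : set 'rV[R]_d) (hL : is_lattice L) (hY : is_unit_cell L Y)
    (s : R) (hs : 0 < s < 1)
    (D : 'I_N -> set 'rV[R]_d) (hD : resonators s Y D)
    (T : R) (hT : 0 < T)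
    (rho kappa : 'I_N -> R -> R)
    (hrho : forall i, modulation T (rho i))
    (hkappa : forall i, modulation T (kappa i))
    (delta kappa_r rho_r : R)
    (hdelta : 0 < delta) (hkappa_r : 0 < kappa_r) (hrho_r : 0 < rho_r)
    (hN : (0 < N < 3)%N)
    (alpha : 'rV[R]_d) (halpha : ~ dual_lattice L alpha) :
  let M (a : 'rV[R]_d) :=
    modulated_matrix (fun i => fine (volume (D i))) delta kappa_r rho_r rho kappa
      (capacitance L Y D a) in
  quasifrequencies T (M alpha) = quasifrequencies T (M (- alpha)).
Proof.
move=> M; rewrite /M.
have [_ D_disjoint _] := hD.
have [u u_neq0 uC] := conj_rescaling_lt3 hN
  (fun i j => capacitance_hermitian L Y D_disjoint alpha i j).
apply: (conjugate_quasifrequencies _ u_neq0); apply: modulated_matrix_rescale => i j.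
apply: (eq_trans (uC i j)); apply: esym; congr (_ * _).
exact: (capacitance_opp L Y D_disjoint alpha i j).
Qed.
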